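(* Let $\mathfrak{A}$ be a unital, simple, purely infinite C$^*$-algebra. Then \[ \mathfrak{A}_{sa} \subseteq \overline{\{M_1 + M_2 \mid M_1, M_2 \in Nil(\mathfrak{A})\}} \] and \[ \mathfrak{A} \subseteq \overline{\{M_1 + M_2 + M_3 + M_4 \mid M_1, M_2, M_3, M_4 \in Nil(\mathfrak{A})\}}. \]
   Context: $\mathfrak{A}_{sa}$ is the set of self-adjoint elements of $\mathfrak{A}$; $Nil(\mathfrak{A})$ is the set of nilpotent elements of $\mathfrak{A}$; closures are in the norm topology. *)

(* Defs.v *)
From HB Require Import structures.
From mathcomp Require Import all_boot all_order all_algebra.
From mathcomp Require Import all_classical all_reals all_analysis.
From mathcomp Require Export complex.
Set Implicit Arguments.
Unset Strict Implicit.
Unset Printing Implicit Defensive.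
Import Order.TTheory GRing.Theory Num.Theory.
Import numFieldNormedType.Exports.
Local Open Scope classical_set_scope.
Local Open Scope ring_scope.

(* The norm takes its values in R[i], as in every normedModType R[i]; R[i] is
   partially ordered with 0 <= z iff z is real and nonnegative.  The mixin has
   its own multiplication because HB accepts no join of nzRingType with
   normedZmodType declared after numDomainType; the algType R[i] instance is
   derived below, so that 1, x * y and x ^+ n apply to elements of A. *)
HB.mixin Record isCStarAlgebra (R : realType) A
    & CompleteNormedModule R[i] A := {
  cstar_one : A;
  cstar_mul : A -> A -> A;
  star : A -> A;
  cstar_mulA : associative cstar_mul;
  cstar_mul1x : left_id cstar_one cstar_mul;
  cstar_mulx1 : right_id cstar_one cstar_mul;
  cstar_mulDl : left_distributive cstar_mul +%R;
  cstar_mulDr : right_distributive cstar_mul +%R;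
  cstar_one_neq0 : cstar_one != 0;
  cstar_scaleAl : forall (l : R[i]) (x y : A),
    l *: cstar_mul x y = cstar_mul (l *: x) y;
  cstar_scaleAr : forall (l : R[i]) (x y : A),
    l *: cstar_mul x y = cstar_mul x (l *: y);
  starK : forall x : A, star (star x) = x;
  starD : forall x y : A, star (x + y) = star x + star y;
  starZ : forall (l : R[i]) (x : A), star (l *: x) = Num.conj l *: star x;
  starM : forall x y : A, star (cstar_mul x y) = cstar_mul (star y) (star x);
  cstar_normM_le : forall x y : A, `|cstar_mul x y| <= `|x| * `|y|;
  cstar_norm_starM : forall x : A, `|cstar_mul (star x) x| = `|x| ^+ 2
}.

#[short(type="cstarAlgType")]
HB.structure Definition CStarAlgebra (R : realType) :=
  {A of CompleteNormedModule R[i] A & isCStarAlgebra R A}.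

#[non_forgetful_inheritance]
HB.instance Definition _ (R : realType) (A : cstarAlgType R) :=
  GRing.Zmodule_isNzRing.Build (CStarAlgebra.sort A)
    (@cstar_mulA R A) (@cstar_mul1x R A) (@cstar_mulx1 R A)
    (@cstar_mulDl R A) (@cstar_mulDr R A) (@cstar_one_neq0 R A).

#[non_forgetful_inheritance]
HB.instance Definition _ (R : realType) (A : cstarAlgType R) :=
  GRing.Lmodule_isLalgebra.Build R[i] (CStarAlgebra.sort A)
    (@cstar_scaleAl R A).

#[non_forgetful_inheritance]
HB.instance Definition _ (R : realType) (A : cstarAlgType R) :=
  GRing.Lalgebra_isAlgebra.Build R[i] (CStarAlgebra.sort A)
    (@cstar_scaleAr R A).

Definition selfadjoint (R : realType) (A : cstarAlgType R) (x : A) : Prop :=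
  star x = x.

Definition nilpotent_element (R : realType) (A : cstarAlgType R) (x : A) : Prop :=
  exists n : nat, x ^+ n = 0.

Definition invertible (R : realType) (A : cstarAlgType R) (x : A) : Prop :=
  exists y : A, x * y = 1 /\ y * x = 1.

Definition spectrum (R : realType) (A : cstarAlgType R) (x : A) : set R[i] :=
  [set l | ~ invertible (x - l%:A)].

Definition positive (R : realType) (A : cstarAlgType R) (x : A) : Prop :=
  selfadjoint x /\ forall l : R[i], spectrum x l -> 0 <= l.

Definition projection (R : realType) (A : cstarAlgType R) (p : A) : Prop :=
  selfadjoint p /\ p * p = p.

Definition mvn_equivalent (R : realType) (A : cstarAlgType R) (p q : A) : Prop :=
  exists v : A, star v * v = p /\ v * star v = q.

(* For projections, p * q = q says that q is a subprojection of p. *)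
Definition infinite_projection (R : realType) (A : cstarAlgType R) (p : A) :
    Prop :=
  projection p /\
  exists q : A, [/\ projection q, p * q = q, q <> p & mvn_equivalent p q].

Definition two_sided_ideal (R : realType) (A : cstarAlgType R) (J : set A) :
    Prop :=
  [/\ J 0, forall x y : A, J x -> J y -> J (x + y),
      forall a x : A, J x -> J (a * x) & forall a x : A, J x -> J (x * a)].

Definition simple_cstar (R : realType) (A : cstarAlgType R) : Prop :=
  forall J : set A, two_sided_ideal J -> closed J ->
    J = [set 0] \/ J = [set: A].

(* A C*-subalgebra need not contain the unit of A. *)
Definition cstar_subalgebra (R : realType) (A : cstarAlgType R) (B : set A) :
    Prop :=
  [/\ B 0 /\ closed B,
      forall x y : A, B x -> B y -> B (x + y),
      forall (l : R[i]) (x : A), B x -> B (l *: x),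
      forall x y : A, B x -> B y -> B (x * y) &
      forall x : A, B x -> B (star x)].

Definition hereditary (R : realType) (A : cstarAlgType R) (B : set A) : Prop :=
  forall x y : A, positive x -> positive (y - x) -> B y -> B x.

(* Cuntz's definition, for simple algebras: every nonzero hereditary
   C*-subalgebra contains an infinite projection. *)
Definition purely_infinite (R : realType) (A : cstarAlgType R) : Prop :=
  forall B : set A, cstar_subalgebra B -> hereditary B -> B <> [set 0] ->
    exists2 p : A, B p & infinite_projection p.

(* Main.v *)
Require Import Defs.
From mathcomp Require Import all_boot all_order all_algebra.
From mathcomp Require Import all_classical all_reals all_analysis.
From mathcomp Require Import ring lra.
From Stdlib Require Ncring Ncring_tac.
Set Implicit Arguments.
Unset Strict Implicit.
Unset Printing Implicit Defensive.
Import Order.TTheory GRing.Theory Num.Theory.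
Import numFieldNormedType.Exports.
Local Open Scope classical_set_scope.
Local Open Scope ring_scope.

(** Every element of the algebra, self-adjoint or not, is a limit of sums of
    two nilpotents; the second inclusion then takes two of the four nilpotents
    to be zero.

    Let [1 = \sum_i E_i] be a finite decomposition into orthogonal idempotents
    with [E_i x E_i = 0] for all [i].  Then [x] is the sum of its strictly upper
    and its strictly lower triangular part, and both are nilpotent
    ([zero_diagonal_nilpotent_sum]).  The [E_i] are arbitrary idempotents, so
    it is enough to make the diagonal of a conjugate of [x] vanish.

    In a simple purely infinite algebra every nonzero [a] is full in the strong
    sense that [b a c = 1] for some [b], [c] ([nonzero_full]).  Fix an idempotent
    [f] other than 0 and 1.  The elements [x] with [(1 - f) x f != 0] are dense,
    and for such an [x] fullness yields [v] such that [v] and [x v] are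
    independent: some [a], [b] have [a v = b x v = 1] and [a x v = b v = 0]
    ([independent_frame]).  Cut [v] into finitely many orthogonal pieces [v_j].
    Relative to the spans [P] of the [v_j], [Q] of the [x v_j] and a remaining
    corner [g], the first block column of [x] is [(0, 1, 0)].  One conjugation
    mixes [Q] into the corner by elements [y_j], another mixes [Q] and the corner
    into [P], and together they clear the whole diagonal as soon as a given
    element of the corner has the form [\sum_j y_j z_j] with [z_j y_j = 0]
    ([frame_nilpotent_sum]).

    Each [y_j z_j] with [z_j y_j = 0] has trace zero for every trace, so such sums
    can exhaust the corner only because there are no traces.  The quantitative
    form of this is an averaging argument: for isometries [s_i] with orthogonal
    ranges and adjoints [s_i'], the map [c |-> n^-1 \sum_(i < n) s_i c s_i'] has norm
    at most [n^(-1/2)], so for large [n] every [t] equals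
    [\sum_(i < n) (c - s_i c s_i')] for some [c]
    ([average_solvable]), and differences of this kind are easily written with
    fixed [y_j] ([coverable_difference], [corner_coverable]).  The number of the
    [y_j] is fixed by [n] before the corner is chosen, so that the
    construction is not circular.

    Fullness comes from the definition of pure infiniteness applied to
    [J \cap J^*], with [J] the closure of [a A]: an infinite projection [p] in it is
    approximated by elements [a b], while simplicity and infiniteness give
    [c p d = 1].  That [J \cap J^*] is hereditary ([hereditary_right_ideal]) needs
    some order theory.  Spectral positivity is traded for the norm condition
    [npos], which is stable under sums, and whose theory rests on a single
    analytic fact, the square root of [1 - k] for [k] of norm less than 1
    ([sqrt_one_sub]). *)

Ltac nc_ring := Ncring_tac.non_commutative_ring.

(** * Zero-diagonal elements of a ring *)

Section NoncommutativeRing.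
Variable A : nzRingType.

#[local] Instance nc_ops :
  @Ncring.Ring_ops A 0 1 +%R *%R (fun x y => x - y) -%R eq := {}.
#[local] Instance nc_ring : Ncring.Ring (Ro := nc_ops).
Proof.
constructor; try typeclasses eauto; intros; try by repeat move=> ? ? ->.
all: by first [exact: add0r | exact: addrC | exact: addrA | exact: mul1r
              | exact: mulr1 | exact: mulrA | exact: mulrDl | exact: mulrDr
              | exact: subrr].
Qed.

Definition nilpotent (x : A) := exists n : nat, x ^+ n = 0.

(** The hypothesis says that [u] is strictly upper triangular: each power of [u]
    kills one more column. *)
Lemma triangular_nilpotent_l (I : finType) (rk : I -> nat) (E : I -> A)
    (u : A) :
  \sum_i E i = 1 ->
  (forall j, u * E j = \sum_(i | (rk i < rk j)%N) E i * (u * E j)) ->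
  nilpotent u.
Proof.
move=> E1 uE.
have key k j : (rk j < k)%N -> u ^+ k * E j = 0.
  elim: k j => // k IH j ltjk; rewrite exprSr -mulrA uE mulr_sumr big1 // => i.
  by move=> ltij; rewrite mulrA IH ?mul0r // (leq_trans ltij).
exists (\max_i rk i).+1.
rewrite -[LHS]mulr1 -[X in _ * X]E1 mulr_sumr big1 // => j _.
by rewrite key // ltnS leq_bigmax.
Qed.

Lemma triangular_nilpotent_r (I : finType) (rk : I -> nat) (E : I -> A)
    (u : A) :
  \sum_i E i = 1 ->
  (forall j, E j * u = \sum_(i | (rk i < rk j)%N) E j * u * E i) ->
  nilpotent u.
Proof.
move=> E1 uE.
have key k j : (rk j < k)%N -> E j * u ^+ k = 0.
  elim: k j => // k IH j ltjk; rewrite exprS mulrA uE mulr_suml big1 // => i.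
  by move=> ltij; rewrite -mulrA IH ?mulr0 // (leq_trans ltij).
exists (\max_i rk i).+1.
rewrite -[LHS]mul1r -[X in X * _]E1 mulr_suml big1 // => j _.
by rewrite key // ltnS leq_bigmax.
Qed.

(** Any enumeration of the index type splits an element without diagonal into a
    strictly upper and a strictly lower triangular part. *)
Lemma zero_diagonal_nilpotent_sum (I : finType) (E : I -> A) (x : A) :
  \sum_i E i = 1 -> (forall i j, i != j -> E i * E j = 0) ->
  (forall i, E i * x * E i = 0) ->
  exists u l, [/\ nilpotent u, nilpotent l & x = u + l].
Proof.
move=> E1 Eorth xE.
have Eid i : E i * E i = E i.
  rewrite -[RHS]mulr1 -E1 mulr_sumr (bigD1 i) //= big1 ?addr0 // => j.
  by rewrite eq_sym => /Eorth.
pose rk (i : I) : nat := enum_rank i.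
pose u := \sum_j \sum_(i | (rk i < rk j)%N) E i * x * E j.
pose l := \sum_j \sum_(i | (rk j < rk i)%N) E i * x * E j.
have uE j : u * E j = \sum_(i | (rk i < rk j)%N) E i * x * E j.
  rewrite /u mulr_suml (bigD1 j) //= [X in _ + X]big1 ?addr0 => [|k kj].
    by rewrite mulr_suml; apply: eq_bigr => i _; rewrite -mulrA Eid.
  by rewrite mulr_suml big1 // => i _; rewrite -mulrA Eorth ?mulr0.
have lE j : E j * l = \sum_(i | (rk i < rk j)%N) E j * x * E i.
  rewrite /l mulr_sumr [RHS]big_mkcond; apply: eq_bigr => k _.
  rewrite mulr_sumr; case: ifP => ltkj.
    rewrite (bigD1 j) //= [X in _ + X]big1 ?addr0 => [|i /andP[_ ij]].
      by rewrite !mulrA Eid.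
    by rewrite !mulrA Eorth ?mul0r // eq_sym.
  rewrite big1 // => i ltki; have [ij|ij] := eqVneq i j.
    by rewrite -ij ltki in ltkj.
  by rewrite !mulrA Eorth ?mul0r // eq_sym.
exists u, l; split.
- apply: (@triangular_nilpotent_l _ rk E) => // j; rewrite uE.
  by apply: eq_bigr => i ltij; rewrite mulr_sumr (bigD1 i) //= big1 ?addr0
       => [|k /andP[_ ki]]; rewrite !mulrA ?Eid // Eorth ?mul0r // eq_sym.
- apply: (@triangular_nilpotent_r _ rk E) => // j; rewrite lE.
  by apply: eq_bigr => i ltij; rewrite mulr_suml (bigD1 i) //= big1 ?addr0
       => [|k /andP[_ ki]]; rewrite -!mulrA ?Eid // Eorth ?mulr0.
rewrite /u /l -big_split -[LHS]mul1r -[LHS]mulr1 -E1 mulr_sumr.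
apply: eq_bigr => j _ /=; rewrite !mulr_suml (bigID (fun i => rk i < rk j)%N) /=.
congr (_ + _); rewrite (bigD1 j) ?ltnn //= xE add0r.
apply: eq_bigl => i; rewrite -leqNgt ltn_neqAle andbC; congr (_ && _).
by rewrite eq_sym /rk (inj_eq val_inj) (inj_eq enum_rank_inj).
Qed.

(** * Clearing the diagonal along an independent frame *)

(** If [x] does not leave the range of [e] invariant, fullness of [(1 - e) x e]
    gives [v0 = e s] and [b0] with [b0 v0 = 0] and [b0 x v0 = 1].  Then
    [1 - x v0 b0] kills [x v0] but fixes the nonzero [v0], which by fullness
    becomes left invertible after right multiplication by some [t]. *)
Lemma independent_frame (x e : A) :
  (forall a : A, a != 0 -> exists r s, r * a * s = 1) ->
  e * e = e -> (1 - e) * x * e != 0 ->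
  exists v a b, [/\ a * v = 1, b * v = 0, a * (x * v) = 0 & b * (x * v) = 1].
Proof.
move=> full ee /full[r [s rs]].
pose v0 := e * s; pose b0 := r * (1 - e).
have b0v0 : b0 * v0 = 0.
  have -> : b0 * v0 = r * (e - e * e) * s by rewrite /b0 /v0; nc_ring.
  by rewrite ee subrr mulr0 mul0r.
have b0xv0 : b0 * x * v0 = 1 by rewrite -rs /b0 /v0; nc_ring.
have v00 : v0 != 0.
  by apply: contra_eq_neq b0xv0 => ->; rewrite mulr0 eq_sym oner_neq0.
have [r' [t r't]] := full _ v00.
exists (v0 * t), (r' * (1 - x * v0 * b0)), (r' * v0 * b0).
split.
- have -> : r' * (1 - x * v0 * b0) * (v0 * t) =
    r' * v0 * t - r' * x * v0 * (b0 * v0) * t by nc_ring.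
  by rewrite b0v0 r't mulr0 mul0r subr0.
- have -> : r' * v0 * b0 * (v0 * t) = r' * v0 * (b0 * v0) * t by nc_ring.
  by rewrite b0v0 mulr0 mul0r.
- have -> : r' * (1 - x * v0 * b0) * (x * (v0 * t)) =
    r' * x * v0 * t - r' * x * v0 * (b0 * x * v0) * t by nc_ring.
  by rewrite b0xv0 mulr1 subrr.
- have -> : r' * v0 * b0 * (x * (v0 * t)) = r' * v0 * (b0 * x * v0) * t.
    by nc_ring.
  by rewrite b0xv0 mulr1.
Qed.

Lemma sum_deltar (J : finType) (i : J) (f : J -> A) :
  \sum_j f j * (j == i)%:R = f i.
Proof.
rewrite (bigD1 i) //= eqxx mulr1 big1 ?addr0 // => j.
by move=> /negPf->; rewrite mulr0.
Qed.

Lemma sum_deltal (J : finType) (i : J) (f : J -> A) :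
  \sum_j (i == j)%:R * f j = f i.
Proof.
rewrite (bigD1 i) //= eqxx mul1r big1 ?addr0 // => j.
by rewrite eq_sym => /negPf->; rewrite mul0r.
Qed.

(** The decomposition may be given by columns [c i] and rows [r i]: the [c i * r i]
    are then orthogonal idempotents, also when [r i * c i] is not 1. *)
Lemma dual_frame_nilpotent_sum (I : finType) (c r : I -> A) (x : A) :
  \sum_i c i * r i = 1 -> (forall i j, i != j -> r i * c j = 0) ->
  (forall i, r i * x * c i = 0) ->
  exists u l, [/\ nilpotent u, nilpotent l & x = u + l].
Proof.
move=> cr1 rc rxc; apply: (@zero_diagonal_nilpotent_sum I (fun i => c i * r i)).
- by [].
- by move=> i j ij; rewrite mulrA -(mulrA (c i)) rc // mulr0 mul0r.
- move=> i; have -> : c i * r i * x * (c i * r i) = c i * (r i * x * c i) * r i.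
    by nc_ring.
  by rewrite rxc mulr0 mul0r.
Qed.

(** If [y' j * y j = 1], the products [y j * z j] with [z j * y j = 0] form the
    off-diagonal corner [p A (1 - p)] of the idempotent [p = y j * y' j]. *)
Definition coverable (J : finType) (y : J -> A) (h : A) :=
  exists z : J -> A, h = \sum_j y j * z j /\ forall j, z j * y j = 0.

Section Frame.
Variables (J : finType) (x : A) (v a b y y' : J -> A) (g : A).
Hypothesis gE : g = 1 - \sum_j v j * a j - \sum_j x * v j * b j.
Hypothesis av : forall i j, a i * v j = (i == j)%:R.
Hypothesis bv : forall i j, b i * v j = 0.
Hypothesis axv : forall i j, a i * x * v j = 0.
Hypothesis bxv : forall i j, b i * x * v j = (i == j)%:R.
Hypothesis gy : forall j, g * y j = y j.
Hypothesis y'y : forall j, y' j * y j = 1.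
Hypothesis cover : forall h, g * h * g = h -> coverable y h.

Let gv i : g * v i = 0.
Proof.
rewrite gE !mulrBl mul1r !mulr_suml.
under eq_bigr => j _ do rewrite -mulrA av.
under [X in _ - _ - X]eq_bigr => j _ do rewrite -[_ * b j * _]mulrA bv mulr0.
by rewrite sum_deltar big1_eq subr0 subrr.
Qed.

Let gxv i : g * x * v i = 0.
Proof.
rewrite -mulrA gE !mulrBl mul1r !mulr_suml.
under eq_bigr => j _ do rewrite -mulrA (mulrA (a j)) axv mulr0.
under [X in _ - _ - X]eq_bigr => j _ do rewrite -[_ * b j * _]mulrA (mulrA (b j)) bxv.
by rewrite (@sum_deltar _ _ (fun j => x * v j)) big1_eq subr0 subrr.
Qed.

Let ag i : a i * g = 0.
Proof.
rewrite gE !mulrBr mulr1 !mulr_sumr.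
under eq_bigr => j _ do rewrite mulrA av.
under [X in _ - _ - X]eq_bigr => j _ do rewrite !mulrA axv mul0r.
by rewrite sum_deltal big1_eq subr0 subrr.
Qed.

Let bg i : b i * g = 0.
Proof.
rewrite gE !mulrBr mulr1 !mulr_sumr.
under eq_bigr => j _ do rewrite mulrA bv mul0r.
under [X in _ - _ - X]eq_bigr => j _ do rewrite !mulrA bxv.
by rewrite sum_deltal big1_eq subr0 subrr.
Qed.

Lemma frame_complement_idempotent : g * g = g.
Proof.
rewrite {1}gE !mulrBl mul1r !mulr_suml.
under eq_bigr => j _ do rewrite -mulrA ag mulr0.
under [X in _ - _ - X]eq_bigr => j _ do rewrite -[_ * b j * _]mulrA bg mulr0.
by rewrite !big1_eq !subr0.
Qed.

Let ay i j : a i * y j = 0.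
Proof. by rewrite -gy mulrA ag mul0r. Qed.

Let by_ i j : b i * y j = 0.
Proof. by rewrite -gy mulrA bg mul0r. Qed.

(** In the block decomposition given by the [v j], the [x v j] and [g], the element
    [x] has first block column [(0, 1, 0)].  Replacing [x v j] by
    [w j = x v j - y j - v j m j], and [g] by [g - \sum_j v j t j], keeps a
    decomposition of 1, with dual rows [b j], [gh] and
    [a j + m j b j + t j gh].  The diagonal entries become
    - [m j + t j y j] at [v j],
    - [d j - b j x y j - m j] at [w j], where [d j = b j x x v j],
    - [g x g + \sum_j y j (b j x g - t j)] at the corner.
    The second vanishes by the choice of [m].  With
    [t j = z j - d j y' j + b j x g] and [z j y j = 0] so does the first, and the
    third asks for [g x g + \sum_j y j d j y' j = \sum_j y j z j]. *)
Lemma frame_nilpotent_sum :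
  exists u l, [/\ nilpotent u, nilpotent l & x = u + l].
Proof.
have gg := frame_complement_idempotent.
pose d j := b j * x * x * v j.
pose h := g * x * g + \sum_j y j * d j * (y' j * g).
have [|z0 [hz zy0]] := cover (h := h).
  rewrite /h mulrDr mulrDl !mulrA gg -(mulrA _ g g) gg; congr (_ + _).
  rewrite mulr_sumr mulr_suml; apply: eq_bigr => j _.
  by rewrite !mulrA gy -(mulrA _ g g) gg.
pose z j := z0 j * g.
have zg j : z j * g = z j by rewrite -mulrA gg.
have zy j : z j * y j = 0 by rewrite -mulrA gy.
have {}hz : h = \sum_j y j * z j.
  have -> : h = h * g.
    rewrite /h mulrDl -(mulrA _ g g) gg; congr (_ + _).
    by rewrite mulr_suml; apply: eq_bigr => j _; rewrite !mulrA -(mulrA _ g g) gg.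
  by rewrite hz mulr_suml; apply: eq_bigr => j _; rewrite mulrA.
(* [t], [m] and [gh] are made opaque: rewriting must not expand them. *)
have [t tE] : exists t, forall j, t j = z j - d j * (y' j * g) + b j * x * g.
  by exists (fun j => z j - d j * (y' j * g) + b j * x * g).
have [m mE] : exists m, forall j, m j = d j - b j * x * y j.
  by exists (fun j => d j - b j * x * y j).
have [gh ghE] : exists gh, gh = g + \sum_j y j * b j by eexists.
pose c (i : J + J + unit) := match i with
  | inl (inl j) => v j
  | inl (inr j) => x * v j - y j - v j * m j
  | inr _ => g - \sum_j v j * t j end.
pose r (i : J + J + unit) := match i with
  | inl (inl j) => a j + m j * b j + t j * gh
  | inl (inr j) => b j
  | inr _ => gh end.
have tg j : t j * g = t j.
  by rewrite tE mulrDl mulrBl zg -!mulrA gg.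
have ghv j : gh * v j = 0.
  rewrite ghE mulrDl gv mulr_suml big1 ?addr0 // => k _.
  by rewrite -mulrA bv mulr0.
have ghxv j : gh * x * v j = y j.
  rewrite ghE !mulrDl gxv !mulr_suml add0r.
  by under eq_bigr => k _ do rewrite -!mulrA (mulrA (b k)) bxv; rewrite sum_deltar.
have ghy j : gh * y j = y j.
  rewrite ghE !mulrDl gy mulr_suml big1 ?addr0 // => k _.
  by rewrite -mulrA by_ mulr0.
have ghg : gh * g = g.
  rewrite ghE mulrDl gg mulr_suml big1 ?addr0 // => k _.
  by rewrite -mulrA bg mulr0.
have gw j : gh * (x * v j - y j - v j * m j) = 0.
  by rewrite !mulrBr !mulrA ghxv ghy ghv mul0r subr0 subrr.
have bw i j : b i * (x * v j - y j - v j * m j) = (i == j)%:R.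
  by rewrite !mulrBr !mulrA bxv by_ bv mul0r !subr0.
have ghk : gh * (g - \sum_j v j * t j) = g.
  rewrite mulrBr ghg mulr_sumr big1 ?subr0 // => j _.
  by rewrite mulrA ghv mul0r.
apply: (@dual_frame_nilpotent_sum _ c r).
- have sum_unit (F : unit -> A) : \sum_i F i = F tt.
    by rewrite (bigD1 tt) //= big1 ?addr0 // => -[].
  rewrite !big_sumType sum_unit /=.
  pose sva := \sum_j v j * a j; pose sxvb := \sum_j x * v j * b j.
  pose svmb := \sum_j v j * m j * b j; pose svt := \sum_j v j * t j.
  pose syb := \sum_j y j * b j.
  have -> : \sum_j v j * (a j + m j * b j + t j * gh) = sva + svmb + svt * gh.
    rewrite mulr_suml -!big_split; apply: eq_bigr => j _ /=; nc_ring.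
  have -> : \sum_j (x * v j - y j - v j * m j) * b j = sxvb - syb - svmb.
    rewrite -!sumrB; apply: eq_bigr => j _ /=; nc_ring.
  have ggh : g * gh = g + syb.
    rewrite ghE mulrDr gg mulr_sumr; congr (_ + _).
    by apply: eq_bigr => j _; rewrite mulrA gy.
  rewrite mulrBl ggh gE -/sva -/sxvb -/svt; nc_ring.
- case=> [[i|i]|[]] [[j|j]|[]] //= ij.
  + rewrite !mulrDl av -!mulrA bv ghv !mulr0 !addr0.
    by rewrite (negPf (ij : i != j)).
  + rewrite !mulrDl -!mulrA bw gw mulr0 addr0 !mulrBr !mulrA axv ay av subr0 sub0r.
    by case: eqVneq => [->|_]; rewrite ?mul1r ?mulr1 ?mul0r ?mulr0 ?oppr0 ?addr0 ?addNr.
  + have bk : b i * (g - \sum_j v j * t j) = 0.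
      rewrite mulrBr bg mulr_sumr big1 ?subr0 // => k _.
      by rewrite mulrA bv mul0r.
    rewrite !mulrDl -!mulrA bk ghk tg mulr0 addr0 mulrBr ag sub0r mulr_sumr.
    under eq_bigr => k _ do rewrite mulrA av.
    by rewrite sum_deltal addNr.
  + by rewrite bw (negPf (ij : i != j)).
  + rewrite mulrBr bg mulr_sumr big1 ?subr0 // => k _.
    by rewrite mulrA bv mul0r.
- case=> [[j|j]|[]] /=.
  + rewrite !mulrDl axv -!mulrA (mulrA (b j)) bxv eqxx mulr1 (mulrA gh) ghxv.
    rewrite add0r mE tE !mulrDl mulNr zy -!mulrA gy y'y mulr1 /d; nc_ring.
  + rewrite !mulrBr !mulrA bxv eqxx mul1r mE /d; nc_ring.
  + rewrite mulrBr mulr_sumr.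
    under eq_bigr => j _ do rewrite mulrA ghxv.
    rewrite ghE !mulrDl !mulr_suml.
    have -> : \sum_j y j * t j = \sum_j y j * z j -
       \sum_j y j * d j * (y' j * g) + \sum_j y j * b j * x * g.
      rewrite -sumrB -big_split; apply: eq_bigr => j _ /=; rewrite tE; nc_ring.
    rewrite -hz /h; nc_ring.
Qed.
End Frame.

(** * Exhausting a corner without traces *)

Lemma coverable1 (J : finType) (y : J -> A) (i : J) (u z : A) :
  y i = u -> z * u = 0 -> coverable y (u * z).
Proof.
move=> <- zy; exists (fun j => if j == i then z else 0); split.
  rewrite (bigD1 i) //= eqxx big1 ?addr0 // => j /negPf->.
  by rewrite mulr0.
by move=> j; case: eqP => [->//|_]; rewrite mul0r.
Qed.

Lemma coverableD (J : finType) (y : J -> A) (h k : A) :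
  coverable y h -> coverable y k -> coverable y (h + k).
Proof.
move=> [z [-> zy]] [t [-> ty]]; exists (fun j => z j + t j); split.
  by rewrite -big_split; apply: eq_bigr => j _; rewrite mulrDr.
by move=> j; rewrite mulrDl zy ty addr0.
Qed.

Lemma coverable_sum (J : finType) (y : J -> A) (n : nat) (h : 'I_n -> A) :
  (forall i, coverable y (h i)) -> coverable y (\sum_(i < n) h i).
Proof.
move=> yh; elim/big_rec: _ => [|i k _ yk]; last exact: coverableD.
by exists (fun=> 0); split=> [|j]; rewrite ?mul0r // big1 // => j _; rewrite mulr0.
Qed.

(** The column [u + w] and the row [c (u' - w')] have product zero in the order row
    times column, and their product in the other order is the given difference up
    to two off-diagonal terms.  This is how a copy of [c] moves from the range of
    [u] to the range of [w]. *)
Lemma coverable_difference (J : finType) (y : J -> A) (i j k : J)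
    (u u' w w' c : A) :
  u' * u = 1 -> w' * w = 1 -> u' * w = 0 -> w' * u = 0 ->
  y i = u + w -> y j = u -> y k = w ->
  coverable y (u * c * u' - w * c * w').
Proof.
move=> uu ww uw wu yi yj yk.
have -> : u * c * u' - w * c * w' =
    (u + w) * (c * (u' - w')) + u * (c * w') + w * (- c * u') by nc_ring.
apply: coverableD; first apply: coverableD.
- apply: (coverable1 yi).
  have -> : c * (u' - w') * (u + w) =
    c * (u' * u + u' * w - w' * u - w' * w) by nc_ring.
  by rewrite uu uw wu ww addr0 subr0 subrr mulr0.
- by apply: (coverable1 yj); rewrite -mulrA wu mulr0.
- by apply: (coverable1 yk); rewrite -mulrA uw mulr0.
Qed.

Section Covering.
Variables (n : nat) (g : A) (s s' : nat -> A).
Hypothesis gg : g * g = g.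
Hypothesis gs : forall i, g * s i = s i.
Hypothesis s'g : forall i, s' i * g = s' i.
Hypothesis s's : forall i j, s' i * s j = (i == j)%:R.
Hypothesis average_solvable :
  forall t, exists c, t = \sum_(i < n) (c - s i * c * s' i).

(** Write [g = f + s 0 s' 0].  The column [f + s 0] moves the [f]-block of [h] into
    the range of [s 0], and the columns [s 0] and [f + s 0 s l (1 - f)] absorb the
    two off-diagonal blocks.  What remains is [s 0 t s' 0] with
    [t = \sum_(i < n) (c - s i c s' i)], a sum of differences between copies of [c]
    supported on the ranges of [s 0] and of [s 0 s i].  These two ranges are
    nested, so each difference passes through [s 1 s i], whose range is orthogonal
    to both.  The index type does not depend on [g]. *)
Lemma corner_coverable :
  exists (y y' : 'I_4 + 'I_n * 'I_4 -> A),
  [/\ forall j, g * y j = y j, forall j, y' j * y j = 1 &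
      forall h, g * h * g = h -> coverable y h].
Proof.
have ss i : s' i * s i = 1 by rewrite s's eqxx.
have [f fE] : exists f, f = g - s 0 * s' 0 by eexists.
have gf : g * f = f by rewrite fE mulrBr gg mulrA gs.
have fg : f * g = f by rewrite fE mulrBl gg -mulrA s'g.
have fs : f * s 0 = 0 by rewrite fE mulrBl gs -mulrA ss mulr1 subrr.
have s'f : s' 0 * f = 0 by rewrite fE mulrBr s'g mulrA ss mul1r subrr.
have ff : f * f = f by rewrite {1}fE mulrBl gf -mulrA s'f mulr0 subr0.
have wk k i : s' i * s' k * (s k * s i) = 1.
  by rewrite -mulrA (mulrA (s' k)) ss mul1r ss.
have wkl k l i : k != l -> s' i * s' k * (s l * s i) = 0.
  by move=> /negPf kl; rewrite -mulrA (mulrA (s' k)) s's kl mul0r mulr0.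
pose p (j : 'I_4 + 'I_n * 'I_4) : A * A := match j with
  | inl k => nth 0 [:: (s 0, s' 0);
      (f + s 0 * s 0 * (1 - f), f + (1 - f) * s' 0 * s' 0);
      (f + s 0 * s 1 * (1 - f), f + (1 - f) * s' 1 * s' 0);
      (f + s 0, s' 0)] k
  | inr (i, k) => nth 0 [::
      (s 0 + s 1 * s i, s' 0); (s 1 * s i, s' i * s' 1);
      (s 1 * s i + s 0 * s i, s' i * s' 1); (s 0 * s i, s' i * s' 0)] k
  end.
exists (fun j => (p j).1), (fun j => (p j).2); split.
- case=> [[[|[|[|[|//]]]] ?]|[i [[|[|[|[|//]]]] ?]]] /=;
  by rewrite ?mulrDr ?mulrA ?gs ?gf.
- have yk k : (f + (1 - f) * s' k * s' 0) * (f + s 0 * s k * (1 - f)) = 1.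
    have -> : (f + (1 - f) * s' k * s' 0) * (f + s 0 * s k * (1 - f)) =
      f * f + (f * s 0) * s k * (1 - f) + (1 - f) * s' k * (s' 0 * f)
      + (1 - f) * s' k * (s' 0 * s 0) * s k * (1 - f) by nc_ring.
    rewrite ss fs s'f ff !(mul0r, mulr0, addr0, mulr1) -(mulrA _ (s' k)) ss mulr1.
    by rewrite mulrBr mulr1 mulrBl mul1r ff subrr subr0 addrC subrK.
  case=> [[[|[|[|[|//]]]] ?]|[i [[|[|[|[|//]]]] ?]]] /=;
  by rewrite ?yk // ?mulrDr ?wk ?wkl ?s'f ?ss ?add0r ?addr0 // mulrA s's mul0r addr0.
move=> h hh.
set y := (fun j => (p j).1).
pose e := s 0 * s' 0; pose k := h * f + h * s 0.
pose t := h * f + s' 0 * h * s 0.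
(* The column [f + s 0 s l (1 - f)] acts on the range of [f] as the identity. *)
have yf l z : (f + s 0 * s l * (1 - f)) * (f * z) = f * z.
  have -> : (f + s 0 * s l * (1 - f)) * (f * z) =
    f * f * z + s 0 * s l * (f - f * f) * z by nc_ring.
  by rewrite ff subrr mulr0 mul0r addr0.
have -> : h = (f + s 0) * (h * f - h * f * s' 0) + s 0 * ((s' 0 * h - h) * f)
    + (f + s 0 * s 0 * (1 - f)) * (f * (k * (1 - e) * s' 0))
    + (f + s 0 * s 1 * (1 - f)) * (f * (k * e * s' 0)) + s 0 * t * s' 0.
  have gE : g = f + e by rewrite fE /e subrK.
  rewrite !yf -{1}hh gE /t /k /e; nc_ring.
(* It applies to [z = 1 - e] with [l = 0], and to [z = e] with [l = 1]. *)
have zero l z : z * s l = 0 ->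
    f * (k * z * s' 0) * (f + s 0 * s l * (1 - f)) = 0.
  move=> zs; have -> : f * (k * z * s' 0) * (f + s 0 * s l * (1 - f)) =
      f * k * z * (s' 0 * f) + f * k * z * (s' 0 * s 0) * s l * (1 - f) by nc_ring.
  by rewrite s'f ss mulr0 mulr1 add0r -(mulrA _ z) zs mulr0 mul0r.
apply: coverableD; first apply: coverableD; first apply: coverableD;
  first apply: coverableD.
- apply: (@coverable1 _ _ (inl (inord 3))); first by rewrite /y /= inordK.
  have -> : (h * f - h * f * s' 0) * (f + s 0) =
     h * (f * f - f) + h * (f * s 0) + h * f * (1 - s' 0 * s 0)
     - h * f * (s' 0 * f) by nc_ring.
  by rewrite ff fs ss s'f !subrr !mulr0 !addr0 subrr.
- apply: (@coverable1 _ _ (inl (inord 0))); first by rewrite /y /= inordK.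
  by rewrite -mulrA fs mulr0.
- apply: (@coverable1 _ _ (inl (inord 1))); first by rewrite /y /= inordK.
  by apply: zero; rewrite mulrBl mul1r -mulrA ss mulr1 subrr.
- apply: (@coverable1 _ _ (inl (inord 2))); first by rewrite /y /= inordK.
  by apply: zero; rewrite -mulrA s's mulr0.
have [c cE] := average_solvable t.
have -> : s 0 * t * s' 0 = \sum_(i < n)
    ((s 0 * c * s' 0 - (s 1 * s i) * c * (s' i * s' 1)) +
     ((s 1 * s i) * c * (s' i * s' 1) - (s 0 * s i) * c * (s' i * s' 0))).
  by rewrite cE mulr_sumr mulr_suml; apply: eq_bigr => i _; nc_ring.
apply: coverable_sum => i; apply: coverableD.
- have s01 : s' 0 * (s 1 * s i) = 0 by rewrite mulrA s's mul0r.
  have s10 : s' i * s' 1 * s 0 = 0 by rewrite -mulrA s's mulr0.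
  by apply: (@coverable_difference _ y (inr (i, inord 0)) (inl (inord 0))
    (inr (i, inord 1))); rewrite ?ss ?wk // /y /= inordK.
- by apply: (@coverable_difference _ y (inr (i, inord 2)) (inr (i, inord 1))
    (inr (i, inord 3))); rewrite ?wk ?wkl // /y /= inordK.
Qed.
End Covering.

(** The pieces [v s k] with [k > 0] serve as the frame, one for each of the columns
    that cover the corner, and [v s 0] is left in the corner, where
    [v s 0 s i] provides the orthogonal copies of 1. *)
Lemma independent_frame_nilpotent_sum (x v a b : A) (n : nat)
    (s s' : nat -> A) :
  a * v = 1 -> b * v = 0 -> a * (x * v) = 0 -> b * (x * v) = 1 ->
  (forall i j, s' i * s j = (i == j)%:R) ->
  (forall t, exists c,
    t = \sum_(i < n) (c - v * s 0 * s i * c * (s' i * (s' 0 * a)))) ->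
  exists u l, [/\ nilpotent u, nilpotent l & x = u + l].
Proof.
move=> av bv axv bxv s's solv.
pose J := ('I_4 + 'I_n * 'I_4)%type.
pose k (j : J) : nat := (enum_rank j).+1.
have kE i j : (k i == k j) = (i == j).
  by rewrite eqSS (inj_eq val_inj) (inj_eq enum_rank_inj).
pose V j := v * s (k j); pose a_ j := s' (k j) * a; pose b_ j := s' (k j) * b.
have [g gE] : exists g, g = 1 - \sum_j V j * a_ j - \sum_j x * V j * b_ j.
  by eexists.
have s'av i j : s' i * (a * (v * s j)) = (i == j)%:R.
  by rewrite (mulrA a) av mul1r s's.
have s'bv i j : s' i * (b * (v * s j)) = 0.
  by rewrite (mulrA b) bv mul0r mulr0.
have s'axv i j : s' i * (a * (x * (v * s j))) = 0.
  by rewrite (mulrA x) (mulrA a) axv mul0r mulr0.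
have s'bxv i j : s' i * (b * (x * (v * s j))) = (i == j)%:R.
  by rewrite (mulrA x) (mulrA b) bxv mul1r s's.
have gv0 : g * (v * s 0) = v * s 0.
  rewrite gE !mulrBl mul1r !mulr_suml !big1 ?subr0 // => j _; rewrite /V.
    by rewrite -!mulrA s'bv !mulr0.
  by rewrite -!mulrA s'av !mulr0.
have a0g : s' 0 * a * g = s' 0 * a.
  rewrite gE !mulrBr mulr1 !mulr_sumr !big1 ?subr0 // => j _; rewrite /V.
    have -> : s' 0 * a * (x * (v * s (k j)) * b_ j) =
      s' 0 * (a * (x * (v * s (k j)))) * b_ j by nc_ring.
    by rewrite s'axv mul0r.
  have -> : s' 0 * a * (v * s (k j) * a_ j) = s' 0 * (a * (v * s (k j))) * a_ j.
    by nc_ring.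
  by rewrite s'av mul0r.
have aV i j : a_ i * V j = (i == j)%:R by rewrite -mulrA s'av kE.
have bV i j : b_ i * V j = 0 by rewrite -mulrA s'bv.
have axV i j : a_ i * x * V j = 0 by rewrite -!mulrA s'axv.
have bxV i j : b_ i * x * V j = (i == j)%:R by rewrite -!mulrA s'bxv kE.
have gg := frame_complement_idempotent gE aV bV axV bxV.
have [||||y [y' [gy y'y cov]]] := @corner_coverable n g
   (fun i => v * s 0 * s i) (fun i => s' i * (s' 0 * a)) gg.
- by move=> i; rewrite mulrA gv0.
- by move=> i; rewrite -mulrA a0g.
- move=> i j; have -> : s' i * (s' 0 * a) * (v * s 0 * s j) =
      s' i * (s' 0 * (a * (v * s 0))) * s j by nc_ring.
  by rewrite s'av mulr1 s's.
- exact: solv.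
exact: (frame_nilpotent_sum gE aV bV axV bxV gy y'y cov).
Qed.

End NoncommutativeRing.

(** * The real-valued norm *)

Section CStar.
Variables (R : realType) (A : cstarAlgType R).
Implicit Types (x y z h k l : A) (r t e : R).

#[local] Instance cstar_nc_ops :
  @Ncring.Ring_ops A 0 1 +%R *%R (fun x y => x - y) -%R eq := nc_ops A.
#[local] Instance cstar_nc_ring : Ncring.Ring (Ro := cstar_nc_ops) := nc_ring A.

(** Real scalars are embedded into the algebra so that all identities are ring
    identities, and [nrm] is the norm with values in the totally ordered [R]. *)
Definition sc (r : R) : A := (r%:C)%C%:A.
Definition nrm (x : A) : R := complex.Re `|x|.

Lemma normE x : `|x| = (nrm x)%:C%C.
Proof.
have : 0 <= `|x| by [].
rewrite /nrm; case: (`|x|) => u w; rewrite lecE /= => /andP[/eqP-> _].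
by [].
Qed.

Lemma nrm_ge0 x : 0 <= nrm x.
Proof. by have : 0 <= `|x| by []; rewrite normE lecR. Qed.

Lemma nrm0 : nrm 0 = 0.
Proof. by rewrite /nrm normr0. Qed.

Lemma nrm_eq0 x : nrm x = 0 -> x = 0.
Proof. by move=> x0; apply/normr0_eq0; rewrite normE x0. Qed.

Lemma nrmD x y : nrm (x + y) <= nrm x + nrm y.
Proof.
by have := ler_normD x y; rewrite !normE -(rmorphD (real_complex R)) lecR.
Qed.

Lemma nrmN x : nrm (- x) = nrm x.
Proof. by rewrite /nrm normrN. Qed.

Lemma nrmB x y : nrm (x - y) <= nrm x + nrm y.
Proof. by rewrite -(nrmN y) nrmD. Qed.

Lemma nrmM x y : nrm (x * y) <= nrm x * nrm y.
Proof.
have : `|x * y| <= `|x| * `|y| by exact: cstar_normM_le.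
by rewrite !normE -(rmorphM (real_complex R)) lecR.
Qed.

Lemma nrm_starM x : nrm (star x * x) = nrm x ^+ 2.
Proof.
have : `|star x * x| = `|x| ^+ 2 by exact: cstar_norm_starM.
by rewrite !normE -(rmorphXn (real_complex R)) => /complexI.
Qed.

Lemma star_mul x y : star (x * y) = star y * star x.
Proof. exact: starM. Qed.

Lemma nrm_star x : nrm (star x) = nrm x.
Proof.
have le_star y : nrm y <= nrm (star y).
  have := nrmM (star y) y; rewrite nrm_starM expr2.
  have := nrm_ge0 y; rewrite le_eqVlt => /orP[/eqP<-|y0]; first by rewrite nrm_ge0.
  by rewrite ler_pM2r.
by apply/le_anti; rewrite le_star -{2}(starK x) le_star.
Qed.

Lemma nrm_Mstar x : nrm (x * star x) = nrm x ^+ 2.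
Proof. by rewrite -{1}(starK x) nrm_starM nrm_star. Qed.

Lemma star1 : star 1 = 1 :> A.
Proof. by rewrite -[LHS]mulr1 -{2}(starK 1) -star_mul mulr1 starK. Qed.

Lemma star0 : star 0 = 0 :> A.
Proof. by apply: (@addrI _ (star 0)); rewrite -starD !addr0. Qed.

Lemma starN x : star (- x) = - star x.
Proof. by apply: (@addrI _ (star x)); rewrite -starD !subrr star0. Qed.

Lemma starB x y : star (x - y) = star x - star y.
Proof. by rewrite starD starN. Qed.

Lemma star_sum n (F : 'I_n -> A) : star (\sum_i F i) = \sum_i star (F i).
Proof. exact: (big_morph star (@starD _ _) star0). Qed.

Lemma nrm1 : nrm (1 : A) = 1.
Proof.
have := nrm_starM 1; rewrite star1 mulr1 => /eqP.
rewrite -subr_eq0 expr2 -{1}(mulr1 (nrm 1)) -mulrBr mulf_eq0 subr_eq0.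
case/orP => /eqP // /nrm_eq0 /eqP; by rewrite oner_eq0.
Qed.

Lemma star_scalar (c : R[i]) : star (c%:A : A) = (Num.conj c)%:A.
Proof. by rewrite starZ star1. Qed.

Lemma scalar_comm (c : R[i]) x : x * c%:A = c%:A * x.
Proof. by rewrite -scalerAl -scalerAr mul1r mulr1. Qed.

Lemma scD r t : sc (r + t) = sc r + sc t.
Proof. by rewrite /sc rmorphD scalerDl. Qed.

Lemma scB r t : sc (r - t) = sc r - sc t.
Proof. by rewrite /sc rmorphB scalerBl. Qed.

Lemma scM r t : sc (r * t) = sc r * sc t.
Proof. by rewrite /sc rmorphM -scalerAl mul1r scalerA. Qed.

Lemma sc0 : sc 0 = 0.
Proof. by rewrite /sc scale0r. Qed.

Lemma sc1 : sc 1 = 1.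
Proof. by rewrite /sc scale1r. Qed.

Lemma sc_comm r x : x * sc r = sc r * x.
Proof. exact: scalar_comm. Qed.

Lemma star_sc r : star (sc r) = sc r.
Proof. by rewrite star_scalar; congr (_ *: _); exact: conjc_real. Qed.

Lemma nrmZ r x : nrm (sc r * x) = `|r| * nrm x.
Proof.
apply: complexI; rewrite (rmorphM (real_complex R)) -normE /sc -scalerAl mul1r.
rewrite normrZ; congr (_ * _); last exact: normE.
by rewrite normc_def /= expr0n addr0 sqrtr_sqr.
Qed.

Lemma nrm_sc r : nrm (sc r) = `|r|.
Proof. by rewrite -[sc r]mulr1 nrmZ nrm1 mulr1. Qed.

Lemma closureP (S : set A) x :
  closure S x <-> forall e, 0 < e -> exists2 y, S y & nrm (x - y) < e.
Proof.
split=> [clx e e0|H B /nbhs_ballP[/= e e0 sB]].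
  have e0' : 0 < (e%:C)%C :> R[i] by rewrite ltcR.
  have [y [Sy]] := clx _ (nbhsx_ballx x _ e0').
  by rewrite -ball_normE /= normE ltcR => ?; exists y.
have [eI eR] : complex.Im e = 0 /\ 0 < complex.Re e.
  by case: e e0 {sB} => u w; rewrite /= ltcE /= => /andP[/eqP-> ].
have [y Sy xy] := H _ eR.
exists y; split=> //; apply: sB; rewrite -ball_normE /= normE.
by rewrite (_ : e = (complex.Re e)%:C%C) ?ltcR //; case: e eI {e0 eR xy} => u w /= ->.
Qed.

(** * Fixed points, inverses and square roots *)

Lemma expr_small q e : 0 <= q < 1 -> 0 < e -> exists n : nat, q ^+ n < e.
Proof.
move=> /andP[q0 q1] e0.
have /cvgrPdist_lt/(_ _ e0)[N _ /(_ N (leqnn N))] :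
  (GRing.exp q : R^nat) @ \oo --> (0 : R) by apply: cvg_expr; rewrite ger0_norm.
by rewrite /= sub0r normrN ger0_norm ?exprn_ge0 // => ?; exists N.
Qed.

Lemma real_gt0 (e : R[i]) : 0 < e -> exists2 r : R, 0 < r & e = r%:C%C.
Proof.
case: e => u w; rewrite ltcE /= => /andP[/eqP-> u0].
by exists u.
Qed.

Lemma complete_geometric (u : nat -> A) (q d : R) : 0 <= q < 1 ->
  (forall n, nrm (u n.+1 - u n) <= q ^+ n * d) ->
  exists l, forall e, 0 < e -> exists N, forall n, (N <= n)%N -> nrm (l - u n) < e.
Proof.
move=> q01 ud; have /andP[q0 q1] := q01.
have d0 : 0 <= d.
  by have := ud 0; rewrite expr0 mul1r; apply: le_trans; exact: nrm_ge0.
have dist n m : nrm (u (n + m)%N - u n) <= q ^+ n * (d / (1 - q)).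
  have : nrm (u (n + m)%N - u n) <= q ^+ n * (d / (1 - q)) * (1 - q ^+ m).
    elim: m => [|m IH]; first by rewrite addn0 subrr nrm0 expr0 subrr mulr0.
    have -> : u (n + m.+1)%N - u n = (u (n + m).+1 - u (n + m)%N) + (u (n + m)%N - u n).
      by rewrite addnS addrA subrK.
    apply: le_trans (nrmD _ _) _; apply: le_trans (lerD (ud _) IH) _.
    rewrite exprD exprS le_eqVlt; apply/orP; left; apply/eqP; field.
    by rewrite subr_eq0 eq_sym lt_eqF.
  move/le_trans; apply; rewrite -[leRHS]mulr1 ler_wpM2l ?gerBl ?exprn_ge0 //.
  by rewrite mulr_ge0 ?exprn_ge0 // divr_ge0 // subr_ge0 ltW.
have small e : 0 < e -> exists N, forall n, nrm (u (N + n)%N - u N) < e.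
  move=> e0; have c0 : 0 <= d / (1 - q) by rewrite divr_ge0 // subr_ge0 ltW.
  have [|N qN] := @expr_small q (e / (1 + d / (1 - q))) q01.
    by rewrite divr_gt0 // ltr_pwDl.
  exists N => n; apply: le_lt_trans (dist _ _) _.
  rewrite ltr_pdivlMr ?ltr_pwDl // in qN; apply: le_lt_trans qN.
  by rewrite ler_wpM2l ?exprn_ge0 // lerDr.
have : cauchy (u @ \oo).
  apply: cauchy_exP => _ /real_gt0[e e0 ->]; have [N uN] := small _ e0.
  exists (u N); exists N => // n /= Nn; rewrite -ball_normE /= normE ltcR.
  by rewrite -opprB nrmN -(subnKC Nn).
move/cauchy_cvg => /cvg_ex[l ul]; exists l => e e0.
have e0' : 0 < e%:C%C :> R[i] by rewrite ltcR.
have /cvgrPdist_lt/(_ _ e0')[N _ lN] := ul.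
by exists N => n /lN; rewrite /= normE ltcR.
Qed.

(** Banach's fixed point theorem on a closed subset [K], over complex scalars. *)
Lemma fixed_point (K : A -> Prop) (f : A -> A) (q : R) (x0 : A) :
  0 <= q < 1 -> K x0 -> (forall x, K x -> K (f x)) ->
  (forall x y, K x -> K y -> nrm (f x - f y) <= q * nrm (x - y)) ->
  (forall l, (forall e, 0 < e -> exists2 u, K u & nrm (l - u) < e) -> K l) ->
  exists2 x, K x & f x = x.
Proof.
move=> q01 Kx0 Kf ctr Kcl.
have Ku n : K (iter n f x0) by elim: n => //= n; exact: Kf.
have [|l ul] := @complete_geometric (fun n => iter n f x0) q (nrm (f x0 - x0)) q01.
  elim=> [|n IH]; first by rewrite expr0 mul1r.
  rewrite exprS -mulrA; apply: le_trans (ler_wpM2l (andP q01).1 IH).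
  exact: (ctr _ _ (Ku n.+1) (Ku n)).
have Kl : K l.
  by apply: Kcl => e /ul[N /(_ N (leqnn _)) ?]; exists (iter N f x0).
exists l => //; apply/eqP; rewrite -subr_eq0; apply/eqP/nrm_eq0/le_anti.
rewrite nrm_ge0 andbT; apply/ler_addgt0Pr => e e0; rewrite add0r.
have [|N uN] := ul (e / 2); first by rewrite divr_gt0.
have -> : f l - l = (f l - f (iter N f x0)) - (l - iter N.+1 f x0).
  by rewrite opprB addrA subrK.
apply: le_trans (nrmB _ _) _.
have h1 := uN N (leqnn _); have h2 := uN N.+1 (leqnSn _).
have := ctr _ _ Kl (Ku N).
have := nrm_ge0 (l - iter N f x0); have /andP[q0 q1] := q01.
by move: h1 h2; move: (nrm _) => a; move: (nrm _) => b; move: (nrm _) => c; nra.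
Qed.

Lemma invertibleM x y : invertible x -> invertible y -> invertible (x * y).
Proof.
move=> [x' [xx' x'x]] [y' [yy' y'y]]; exists (y' * x'); split.
  by rewrite mulrA -(mulrA x) yy' mulr1.
by rewrite mulrA -(mulrA y') x'x mulr1.
Qed.

(** A right and a left inverse are the fixed points of [y |-> 1 + k y] and
    [y |-> 1 + y k]. *)
Lemma neumann k : nrm k < 1 -> invertible (1 - k).
Proof.
move=> k1; have k01 : 0 <= nrm k < 1 by rewrite nrm_ge0.
have [|||y _ yE] // := @fixed_point (fun=> True) (fun y => 1 + k * y) (nrm k) 0 k01 I.
  move=> x y _ _; have -> : 1 + k * x - (1 + k * y) = k * (x - y) by nc_ring.
  exact: nrmM.
have [|||z _ zE] // := @fixed_point (fun=> True) (fun y => 1 + y * k) (nrm k) 0 k01 I.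
  move=> x z _ _; have -> : 1 + x * k - (1 + z * k) = (x - z) * k by nc_ring.
  by rewrite mulrC nrmM.
have ky : (1 - k) * y = 1 by rewrite mulrBl mul1r -{1}yE addrK.
have zk : z * (1 - k) = 1 by rewrite mulrBr mulr1 -{1}zE addrK.
have yz : z = y by rewrite -[z]mulr1 -ky mulrA zk mul1r.
by exists y; split=> //; rewrite -yz.
Qed.

Lemma invertible_near1 x : nrm (1 - x) < 1 -> invertible x.
Proof. by move=> /neumann; rewrite opprB addrC subrK. Qed.

Lemma selfadjoint_closed l :
  (forall e, 0 < e -> exists2 u, selfadjoint u & nrm (l - u) < e) ->
  selfadjoint l.
Proof.
move=> H; apply/eqP; rewrite -subr_eq0; apply/eqP/nrm_eq0/le_anti.
rewrite nrm_ge0 andbT; apply/ler_addgt0Pr => e e0; rewrite add0r.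
have [|u us lu] := H (e / 2); first by rewrite divr_gt0.
have -> : star l - l = star (l - u) - (l - u).
  by rewrite starB us opprB addrA subrK.
apply: le_trans (nrmB _ _) _; rewrite nrm_star; lra.
Qed.

Lemma commute_closed l c :
  (forall e, 0 < e -> exists2 u, u * c = c * u & nrm (l - u) < e) ->
  l * c = c * l.
Proof.
move=> H; apply/eqP; rewrite -subr_eq0; apply/eqP/nrm_eq0/le_anti.
rewrite nrm_ge0 andbT; apply/ler_addgt0Pr => e e0; rewrite add0r.
have c0 := nrm_ge0 c.
have e'0 : 0 < e / (2 * (1 + nrm c)) by rewrite divr_gt0 // mulr_gt0 // ltr_pwDl.
have [u uc lu] := H _ e'0.
have -> : l * c - c * l = (l - u) * c - c * (l - u).
  have -> : (l - u) * c - c * (l - u) = l * c - c * l - (u * c - c * u) by nc_ring.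
  by rewrite uc subrr subr0.
apply: le_trans (nrmB _ _) _.
apply: le_trans (lerD (nrmM _ _) (nrmM _ _)) _.
rewrite ltr_pdivlMr ?mulr_gt0 ?ltr_pwDl // in lu.
have := nrm_ge0 (l - u); move: lu c0; move: (nrm _) (nrm _) => a b; nra.
Qed.

(** [(1 - y)^2 = 1 - k] says [y = (k + y^2) / 2], and on the ball of radius [nrm k]
    the right-hand side is a contraction.  It preserves the closed set of
    self-adjoint elements commuting with everything that commutes with [k]. *)
Lemma sqrt_one_sub k : selfadjoint k -> nrm k < 1 ->
  exists l, [/\ selfadjoint l, l * l = 1 - k &
    forall c, k * c = c * k -> l * c = c * l].
Proof.
move=> ks k1; set s := nrm k; have s0 : 0 <= s := nrm_ge0 k.
pose K y := [/\ selfadjoint y, nrm y <= s &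
  forall c, k * c = c * k -> y * c = c * y].
have half0 : 0 <= 2^-1 :> R by rewrite invr_ge0.
have [|||||y [ys yn yc] yE] := @fixed_point K (fun y => sc 2^-1 * (k + y * y)) s 0.
- by rewrite s0.
- split=> [||c _]; rewrite ?nrm0 ?mul0r ?mulr0 //; exact: star0.
- move=> x [xs xn xc]; split.
  + by rewrite /selfadjoint star_mul star_sc starD star_mul xs ks sc_comm.
  + rewrite nrmZ ger0_norm //.
    have := nrmD k (x * x); have := nrmM x x; have := nrm_ge0 x.
    rewrite -/s in k1 *; move: xn; move: (nrm x) (nrm (x * x)) (nrm (k + _)).
    by move=> a b c *; nra.
  + move=> c kc; rewrite mulrA sc_comm -!mulrA; congr (_ * _).
    by rewrite mulrDl mulrDr kc -mulrA (xc c kc) mulrA (xc c kc) mulrA.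
- move=> x y [xs xn xc] [ys yn yc].
  have -> : sc 2^-1 * (k + x * x) - sc 2^-1 * (k + y * y) =
     sc 2^-1 * (x * (x - y) + (x - y) * y) by nc_ring.
  rewrite nrmZ ger0_norm //.
  have := nrmD (x * (x - y)) ((x - y) * y); have := nrmM x (x - y).
  have := nrmM (x - y) y; have := nrm_ge0 (x - y); move: xn yn.
  move: (nrm x) (nrm y) (nrm (x - y)) (nrm (x * _)) (nrm (_ * y)) (nrm (_ + _)).
  by move=> a b c d e g *; nra.
- move=> l H; split.
  + by apply: selfadjoint_closed => e /H[u [us _ _]]; exists u.
  + apply/ler_addgt0Pr => e /H[u [_ un _] lu].
    have := nrmD (l - u) u; rewrite subrK => /le_trans; apply.
    by rewrite addrC lerD // ltW.
  + move=> c kc; apply: commute_closed => e /H[u [_ _ uc] lu]; exists u => //.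
    exact: uc.
exists (1 - y); split.
- by rewrite /selfadjoint starB star1 ys.
- have E : y + y = k + y * y.
    have half2 : sc 2^-1 + sc 2^-1 = 1.
      by rewrite -scD (_ : 2^-1 + 2^-1 = 1) ?sc1 //; field.
    by rewrite -[RHS]mul1r -half2 mulrDl yE.
  have -> : (1 - y) * (1 - y) = 1 - (y + y) + y * y by nc_ring.
  by rewrite E; nc_ring.
- by move=> c /yc yc'; rewrite mulrBl mulrBr mul1r mulr1 yc'.
Qed.

(** * Positivity through the norm *)

Lemma sa_sc r : selfadjoint (sc r). Proof. exact: star_sc. Qed.

Lemma saD x y : selfadjoint x -> selfadjoint y -> selfadjoint (x + y).
Proof. by rewrite /selfadjoint starD => -> ->. Qed.

Lemma saB x y : selfadjoint x -> selfadjoint y -> selfadjoint (x - y).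
Proof. by rewrite /selfadjoint starB => -> ->. Qed.

Lemma sa_mul x y : selfadjoint x -> selfadjoint y -> x * y = y * x ->
  selfadjoint (x * y).
Proof. by rewrite /selfadjoint star_mul => -> ->. Qed.

Lemma sc_mulVr r x : r != 0 -> sc r * (sc r^-1 * x) = x.
Proof. by move=> r0; rewrite mulrA -scM divff // sc1 mul1r. Qed.

(** This is the usual characterization of positive elements by the norm.  Unlike
    positivity of the spectrum it is visibly stable under sums. *)
Definition npos h := selfadjoint h /\ exists2 t, 0 <= t & nrm (sc t - h) <= t.

Lemma npos_sa h : npos h -> selfadjoint h. Proof. by case. Qed.

Lemma npos_sc r : 0 <= r -> npos (sc r).
Proof. by move=> r0; split; [exact: sa_sc|exists r => //; rewrite subrr nrm0]. Qed.

Lemma nposD h k : npos h -> npos k -> npos (h + k).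
Proof.
move=> [hs [t t0 ht]] [ks [r r0 kr]]; split; first exact: saD.
exists (t + r); first exact: addr_ge0.
have -> : sc (t + r) - (h + k) = (sc t - h) + (sc r - k) by rewrite scD; nc_ring.
exact: le_trans (nrmD _ _) (lerD ht kr).
Qed.

Lemma nposZ r h : 0 <= r -> npos h -> npos (sc r * h).
Proof.
move=> r0 [hs [t t0 ht]]; split.
  by apply: sa_mul => //; [exact: sa_sc|rewrite sc_comm].
exists (r * t); first exact: mulr_ge0.
by rewrite scM -mulrBr nrmZ ger0_norm // ler_wpM2l.
Qed.

Lemma npos_sub_small h t : selfadjoint h -> nrm h <= t -> npos (sc t - h).
Proof.
move=> hs ht; split; first by apply: saB => //; exact: sa_sc.
by exists t; rewrite ?(le_trans (nrm_ge0 h)) // opprB addrC subrK.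
Qed.

Lemma npos_add_small h t : selfadjoint h -> nrm h <= t -> npos (sc t + h).
Proof.
move=> hs ht; rewrite -(opprK h); apply: npos_sub_small; last by rewrite nrmN.
by rewrite /selfadjoint starN hs.
Qed.

(** Up to a positive factor [h + sc e] is [1 - k] with [nrm k < 1]. *)
Lemma npos_sqrt h e : npos h -> 0 < e ->
  exists l, [/\ selfadjoint l, l * l = h + sc e &
    forall c, h * c = c * h -> l * c = c * l].
Proof.
move=> [hs [t t0 ht]] e0; pose T := t + e; have T0 : 0 < T by rewrite ltr_wpDl.
pose k := sc T^-1 * (sc t - h).
have [||l [ls lk lc]] := @sqrt_one_sub k.
- apply: sa_mul; [exact: sa_sc| |by rewrite sc_comm].
  by apply: saB => //; exact: sa_sc.
- rewrite nrmZ ger0_norm ?invr_ge0 1?ltW // mulrC ltr_pdivrMr // mul1r.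
  by apply: le_lt_trans ht _; rewrite ltrDl.
exists (sc (Num.sqrt T) * l); split.
- by apply: sa_mul => //; [exact: sa_sc|rewrite sc_comm].
- have -> : sc (Num.sqrt T) * l * (sc (Num.sqrt T) * l) =
      sc (Num.sqrt T) * (l * sc (Num.sqrt T)) * l by nc_ring.
  rewrite sc_comm !mulrA -scM -expr2 sqr_sqrtr 1?ltW // -mulrA lk mulrBr mulr1.
  by rewrite sc_mulVr ?gt_eqF // scD opprB addrC addrA subrK.
- move=> c hc; rewrite mulrA sc_comm -!mulrA lc // /k !mulrA sc_comm -!mulrA.
  by congr (_ * _); rewrite mulrBl mulrBr hc sc_comm.
Qed.

(** For commuting [l] and [m] the sum [l^2 + m^2] is [star x * x] with
    [x = l + i m], and [l] is the real part of [x]. *)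
Lemma nrm_sqr_le_commuting l m : selfadjoint l -> selfadjoint m ->
  l * m = m * l -> nrm l ^+ 2 <= nrm (l * l + m * m).
Proof.
(* The imaginary unit, as a central element of the algebra. *)
move=> ls ms lm; pose j : A := ('i%C : R[i])%:A.
have jj : j * j = -1.
  by rewrite /j -scalerAl mul1r scalerA -expr2 sqr_i scaleN1r.
have js : star j = - j.
  rewrite star_scalar -scaleNr; congr (_ *: _).
  by apply/eqP; rewrite -[Num.conj _]/(conjc _) eq_complex /= oppr0 !eqxx.
have jc c : c * j = j * c by exact: scalar_comm.
pose x := l + j * m.
have xs : star x = l - j * m by rewrite starD star_mul js ls ms mulrN jc.
have -> : l * l + m * m = star x * x.
  have -> : star x * x = l * l + (l * j) * m - j * m * l - j * (m * j) * m.
    by rewrite xs /x; nc_ring.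
  by rewrite (jc l) (jc m) -(mulrA j l) lm mulrA addrK mulrA jj mulN1r mulNr opprK.
rewrite nrm_starM ler_sqr ?nnegrE ?nrm_ge0 //.
have -> : l = sc 2^-1 * (x + star x).
  have -> : x + star x = (1 + 1) * l by rewrite xs /x; nc_ring.
  by rewrite mulrA -sc1 -scD -scM mulVf ?sc1 ?mul1r // (_ : 1 + 1 = 2).
rewrite nrmZ ger0_norm ?invr_ge0 //.
by have := nrmD x (star x); rewrite nrm_star; lra.
Qed.

(** After scaling, [nrm l < 1], so that [1 - l^2 = m^2] with [m] commuting with [l],
    and [nrm (m^2) <= nrm (l^2 + m^2) = 1]. *)
Lemma npos_sqr l : selfadjoint l -> npos (l * l).
Proof.
move=> ls; split; first exact: sa_mul.
pose r := nrm l + 1; have r0 : 0 < r by rewrite ltr_wpDl ?nrm_ge0.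
pose p := sc r^-1 * l.
have ps : selfadjoint p by apply: sa_mul => //; [exact: sa_sc|rewrite sc_comm].
have p1 : nrm p < 1.
  by rewrite nrmZ ger0_norm ?invr_ge0 1?ltW // mulrC ltr_pdivrMr // mul1r ltrDl.
have [||m [ms mp mc]] := @sqrt_one_sub (p * p).
- exact: sa_mul.
- apply: le_lt_trans (nrmM _ _) _.
  by have := nrm_ge0 p; move: p1; move: (nrm p) => a *; nra.
have mpc : m * p = p * m by apply: mc; rewrite mulrA.
have := nrm_sqr_le_commuting ms ps mpc.
rewrite mp subrK nrm1 => m1.
have r2 : 0 <= r ^+ 2 by rewrite exprn_ge0 // ltW.
exists (r ^+ 2) => //.
have -> : sc (r ^+ 2) - l * l = sc (r ^+ 2) * (m * m).
  rewrite mp mulrBr mulr1; congr (_ - _).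
  rewrite /p !mulrA -scM expr2 mulfK ?gt_eqF // -(mulrA _ l) sc_comm !mulrA -scM.
  by rewrite divff ?gt_eqF // sc1 mul1r.
rewrite nrmZ ger0_norm // -[leRHS]mulr1 ler_wpM2l //.
by apply: le_trans (nrmM _ _) _; rewrite -expr2.
Qed.

(** Up to small multiples of 1, both [h] and [t - h] are squares, and their roots
    commute. *)
Lemma npos_bound h t : 0 <= t -> npos h -> npos (sc t - h) -> nrm h <= t.
Proof.
move=> t0 hp thp; apply/ler_addgt0Pr => e e0.
have e3 : 0 < e / 3 by rewrite divr_gt0.
have [k [ks kk kc]] := npos_sqrt hp e3.
have [l [ls ll lc]] := npos_sqrt thp e3.
have hk : h * k = k * h by rewrite kc.
have kl : k * l = l * k.
  by rewrite lc // mulrBl mulrBr hk sc_comm.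
have := nrm_sqr_le_commuting ks ls kl.
have -> : k * k + l * l = sc (t + e / 3 + e / 3) by rewrite kk ll !scD; nc_ring.
rewrite nrm_sc ger0_norm; last lra.
have -> : nrm h = nrm (k * k - sc (e / 3)) by rewrite kk addrK.
have := nrmB (k * k) (sc (e / 3)); have := nrmM k k.
rewrite nrm_sc (ger0_norm (ltW e3)) -expr2; lra.
Qed.

Lemma npos_nrm_sub h t : npos h -> nrm h <= t -> nrm (sc t - h) <= t.
Proof.
move=> hp ht; apply: npos_bound; first exact: le_trans (nrm_ge0 h) ht.
  by apply: npos_sub_small => //; exact: npos_sa.
by rewrite opprB addrC subrK.
Qed.

Lemma npos_limit h : selfadjoint h -> (forall e, 0 < e -> npos (h + sc e)) ->
  npos h.
Proof.
move=> hs hp; split=> //; exists (nrm h + 1); first by rewrite addr_ge0 ?nrm_ge0.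
apply/ler_addgt0Pr => e e0; pose d := Num.min e 1.
have d0 : 0 < d by rewrite lt_min e0 ltr01.
have [de d1] : d <= e /\ d <= 1 by rewrite !ge_min !lexx orbT.
have := @npos_nrm_sub (h + sc d) (nrm h + 1) (hp _ d0).
have := nrmD h (sc d); rewrite nrm_sc (ger0_norm (ltW d0)) => hd.
move/(_ (le_trans hd (lerD (lexx _) d1))) => H.
have -> : sc (nrm h + 1) - h = sc (nrm h + 1) - (h + sc d) + sc d by nc_ring.
by apply: le_trans (nrmD _ _) _; rewrite nrm_sc (ger0_norm (ltW d0)) lerD.
Qed.

Lemma npos_limit_small h :
  selfadjoint h -> (exists2 c, 0 <= c & forall e, 0 < e ->
    exists k, [/\ npos k & nrm (k - h) <= c * e]) ->
  npos h.
Proof.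
move=> hs [c c0 H]; apply: npos_limit => // e e0.
have [|k [kp hk]] := H (e / (c + 1)); first by rewrite divr_gt0 // ltr_wpDl.
have -> : h + sc e = k + (sc e - (k - h)) by nc_ring.
apply: nposD => //; apply: npos_sub_small; first exact: saB (npos_sa kp) hs.
apply: le_trans hk _; rewrite mulrCA ler_piMr ?(ltW e0) //.
by rewrite ler_pdivrMr ?mul1r ?lerDl // ltr_wpDl.
Qed.

(** Up to a small error, the product of two commuting squares is a square. *)
Lemma npos_mul h k : npos h -> npos k -> h * k = k * h -> npos (h * k).
Proof.
move=> hp kp hk; apply: npos_limit_small.
  by apply: sa_mul => //; exact: npos_sa.
exists (nrm h + nrm k + 1) => [|e e0]; first by rewrite !addr_ge0 ?nrm_ge0.
pose d := Num.min e 1; have d0 : 0 < d by rewrite lt_min e0 ltr01.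
have [de d1] : d <= e /\ d <= 1 by rewrite !ge_min !lexx orbT.
have [p [ps pp pc]] := npos_sqrt hp d0.
have [q [qs qq qc]] := npos_sqrt kp d0.
have kph : k * p = p * k by rewrite pc.
have pq : p * q = q * p by rewrite qc.
exists (p * q * (p * q)); split; first by apply: npos_sqr; exact: sa_mul.
have -> : p * q * (p * q) = h * k + sc d * (h + k + sc d).
  have -> : p * q * (p * q) = p * (q * p) * q by nc_ring.
  rewrite -pq.
  have -> : p * (p * q) * q = (p * p) * (q * q) by nc_ring.
  rewrite pp qq.
  have -> : (h + sc d) * (k + sc d) = h * k + h * sc d + sc d * (k + sc d).
    by nc_ring.
  by rewrite sc_comm; nc_ring.
rewrite addrC addKr nrmZ ger0_norm ?(ltW d0) // mulrC.
apply: ler_pM; rewrite ?nrm_ge0 ?(ltW d0) //.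
have := nrmD (h + k) (sc d); have := nrmD h k; rewrite nrm_sc ger0_norm ?(ltW d0) //.
by lra.
Qed.

Lemma npos_shift_invertible h e : npos h -> 0 < e -> invertible (h + sc e).
Proof.
move=> [hs [t t0 ht]] e0; pose T := t + e; have T0 : 0 < T by rewrite ltr_wpDl.
have -> : h + sc e = sc T * (1 - sc T^-1 * (sc t - h)).
  by rewrite mulrBr mulr1 sc_mulVr ?gt_eqF // scD; nc_ring.
apply: invertibleM.
  by exists (sc T^-1); rewrite -!scM mulVf ?gt_eqF // divff ?gt_eqF // sc1.
apply: neumann; rewrite nrmZ ger0_norm ?invr_ge0 1?ltW // mulrC ltr_pdivrMr //.
by rewrite mul1r; apply: le_lt_trans ht _; rewrite ltrDl.
Qed.

(** The inverse [b] of [c] is again [npos], since [b c b] is a limit of squares.  For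
    [T > nrm b] the product [c (T - b) = T c - 1] is [npos], which gives the gap
    [1 / T]. *)
Lemma npos_invertible_gap c : npos c -> invertible c ->
  exists2 d, 0 < d & npos (c - sc d).
Proof.
move=> cp [b [cb bc]].
have cs := npos_sa cp.
have bs : selfadjoint b.
  have h : star b * c = 1 by rewrite -{1}cs -star_mul cb star1.
  by rewrite /selfadjoint -[star b]mulr1 -cb mulrA h mul1r.
have bp : npos b.
  apply: npos_limit_small => //; exists (nrm (b * b)) => [|e e0].
    exact: nrm_ge0.
  have [l [ls ll lc]] := npos_sqrt cp e0.
  have lb : l * b = b * l by rewrite lc // cb bc.
  exists (l * b * (l * b)); split; first by apply: npos_sqr; exact: sa_mul.
  have -> : l * b * (l * b) - b = sc e * (b * b).
    rewrite {1}lb -mulrA (mulrA l) ll.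
    have -> : b * ((c + sc e) * b) = b * c * b + b * sc e * b by nc_ring.
    by rewrite bc mul1r sc_comm addrC addKr mulrA.
  by rewrite nrmZ ger0_norm ?(ltW e0) // mulrC.
pose T := nrm b + 1; have T0 : 0 < T by rewrite ltr_wpDl ?nrm_ge0.
have Tb : npos (sc T - b) by apply: npos_sub_small => //; rewrite lerDl.
have cTb : npos (c * (sc T - b)).
  by apply: npos_mul => //; rewrite mulrBl mulrBr cb bc sc_comm.
exists T^-1; first by rewrite invr_gt0.
have -> : c - sc T^-1 = sc T^-1 * (c * (sc T - b)).
  by rewrite mulrBr cb sc_comm mulrBr mulr1 mulrA -scM mulVf ?gt_eqF // sc1 mul1r.
by apply: nposZ; rewrite ?invr_ge0 ?(ltW T0).
Qed.

(** The shifts [s >= 0] for which [h + s] is [npos] form a closed half-line.  If its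
    end point were positive, [h + s] would be invertible there and the gap lemma
    would push the end point further down. *)
Lemma npos_of_shift_invertible h : selfadjoint h ->
  (forall s : R, 0 < s -> invertible (h + sc s)) -> npos h.
Proof.
move=> hs hinv.
pose S : set R := [set s | 0 <= s /\ npos (h + sc s)].
have Sup s t : S s -> s <= t -> S t.
  move=> [s0 sp] st; split; first exact: le_trans st.
  have -> : h + sc t = h + sc s + sc (t - s) by rewrite scB; nc_ring.
  by apply: nposD => //; apply: npos_sc; rewrite subr_ge0.
have Sinf : has_inf S.
  split; last by exists 0 => s [].
  by exists (nrm h); split; [exact: nrm_ge0|rewrite addrC; exact: npos_add_small].
pose s0 := inf S.
have s00 : 0 <= s0 by apply: lb_le_inf => [|s []//]; case: Sinf.
have Sgt e : 0 < e -> S (s0 + e).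
  move=> e0; have [s Ss lts] := inf_adherent e0 Sinf.
  by apply: Sup Ss _; exact: ltW.
have Ss0 : npos (h + sc s0).
  apply: npos_limit => [|e e0]; first by apply: saD => //; exact: sa_sc.
  by rewrite -addrA -scD; case: (Sgt _ e0).
move: s00; rewrite le_eqVlt => /orP[/eqP s00|s0gt].
  by move: Ss0; rewrite -s00 sc0 addr0.
have [d d0 dp] := npos_invertible_gap Ss0 (hinv _ s0gt).
have : S (Num.max 0 (s0 - d)).
  split; first by rewrite le_max lexx.
  have -> : h + sc (Num.max 0 (s0 - d)) =
      h + sc s0 - sc d + sc (Num.max 0 (s0 - d) - (s0 - d)).
    by rewrite !scB; nc_ring.
  by apply: nposD => //; apply: npos_sc; rewrite subr_ge0 le_max lexx orbT.
move/(ge_inf Sinf.2); rewrite -/s0 leNgt gt_max s0gt /=.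
by rewrite ltrBlDr ltrDl d0.
Qed.

(** By [npos_of_shift_invertible] it is enough to invert [w x w + s], that is
    [w (x + s w^-2) w], and [w^-2] exceeds a positive scalar. *)
Lemma npos_conj w x : selfadjoint w -> invertible w -> npos x ->
  npos (w * x * w).
Proof.
move=> ws winv xp; have xs := npos_sa xp; have [b [wb bw]] := winv.
have bs : selfadjoint b.
  have h : star b * w = 1 by rewrite -{1}ws -star_mul wb star1.
  by rewrite /selfadjoint -[star b]mulr1 -wb mulrA h mul1r.
apply: npos_of_shift_invertible => [|s s0].
  by rewrite /selfadjoint !star_mul ws xs mulrA.
have [|d d0 dp] := npos_invertible_gap (npos_sqr bs).
  by exists (w * w); rewrite !mulrA -(mulrA b b) bw mulr1 bw -(mulrA w w) wb mulr1 wb.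
have -> : w * x * w + sc s = w * (x + sc s * (b * b - sc d) + sc (s * d)) * w.
  have -> : w * (x + sc s * (b * b - sc d) + sc (s * d)) * w =
    w * x * w + w * sc s * b * (b * w) by rewrite scM; nc_ring.
  by rewrite sc_comm -!mulrA bw mulr1 wb mulr1.
apply: invertibleM => //; apply: invertibleM => //.
apply: npos_shift_invertible; last exact: mulr_gt0.
by apply: nposD => //; apply: nposZ => //; exact: ltW.
Qed.

Lemma positive_npos x : positive x -> npos x.
Proof.
move=> [xs xp]; apply: npos_of_shift_invertible => // s s0.
apply/not_notP => ninv.
have : 0 <= ((- s)%:C)%C.
  apply: xp; rewrite /spectrum /= => inv; apply: ninv.
  by move: inv; rewrite rmorphN scaleNr opprK.
by rewrite lecR oppr_ge0 leNgt s0.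
Qed.

(** * Hereditary subalgebras and full elements *)

Lemma small_parameter e (X : R) : 0 < e -> 0 <= X ->
  exists2 d, 0 < d & [/\ d <= e / 4, d <= 1 & 3 * d * (X + 1) <= (e / 2) ^+ 2].
Proof.
move=> e0 X0; pose D := e ^+ 2 / (12 * (X + 1)).
have X1 : 0 < 12 * (X + 1) by rewrite mulr_gt0 // ltr_wpDl.
exists (Num.min (e / 4) (Num.min 1 D)).
  by rewrite !lt_min ltr01 !divr_gt0 ?exprn_gt0.
split; first by rewrite ge_min lexx.
  by rewrite !ge_min lexx orbT.
have : Num.min (e / 4) (Num.min 1 D) <= D by rewrite !ge_min lexx !orbT.
rewrite ler_pdivlMr //; move: (Num.min _ _) => d; rewrite expr2; lra.
Qed.

(** Take [w = (1 + y / d)^-1] for a small [d].  Then [1 - w] lies in [y A], hence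
    [x - w x] in [J], and it has to be shown that [w x] is small.  Conjugation by [w]
    preserves [npos], so [w x w <= w y w = d (w - w^2) <= 2 d]; writing [x] as a
    square [k^2] up to [d], this bounds [w k] and therefore [w x]. *)
Lemma hereditary_right_ideal (J : A -> Prop) x y :
  (forall z a, J z -> J (z * a)) ->
  (forall l, (forall e, 0 < e -> exists2 u, J u & nrm (l - u) < e) -> J l) ->
  npos x -> npos (y - x) -> J y -> J x.
Proof.
move=> Jmul Jcl xp yxp Jy; apply: Jcl => e e0.
have [d d0 [de d1 dX]] := small_parameter e0 (nrm_ge0 x).
have xs := npos_sa xp.
have yp : npos y by rewrite -(subrK x y); exact: nposD.
pose Y := sc d^-1 * y.
have Yp : npos Y by apply: nposZ => //; rewrite invr_ge0 ltW.
pose c := Y + sc 1.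
have [w [cw wc]] := npos_shift_invertible Yp ltr01.
have cs : selfadjoint c by apply: saD; [exact: npos_sa|exact: sa_sc].
have ws : selfadjoint w.
  have h : star w * c = 1 by rewrite -{1}cs -star_mul cw star1.
  by rewrite /selfadjoint -[star w]mulr1 -cw mulrA h mul1r.
have winv : invertible w by exists c.
have wYw : w - w * w = w * Y * w.
  have -> : w * Y * w = w * c * w - w * sc 1 * w by rewrite /c; nc_ring.
  by rewrite wc mul1r sc1 mulr1.
have w1 : nrm w <= 1.
  apply: npos_bound => //.
    rewrite -(subrK (w * w) w) wYw; apply: nposD; last exact: npos_sqr.
    exact: npos_conj.
  have -> : sc 1 - w = w * (Y + Y * Y) * w.
    have -> : w * (Y + Y * Y) * w = w * c * (c * w) - w * c * w.
      by rewrite /c sc1; nc_ring.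
    by rewrite wc cw sc1 !mul1r.
  by apply: npos_conj => //; apply: nposD => //; apply: npos_sqr; exact: npos_sa.
have ww1 : nrm (w * w) <= 1.
  by apply: le_trans (nrmM _ _) _; rewrite mulr_ile1 ?nrm_ge0.
have wyw : nrm (w * y * w) <= 2 * d.
  have -> : w * y * w = sc d * (w * Y * w).
    have -> : sc d * (w * Y * w) = (sc d * w) * sc d^-1 * y * w by rewrite /Y; nc_ring.
    by rewrite -(sc_comm d w) -(mulrA w (sc d)) -scM divff ?gt_eqF // sc1 mulr1.
  rewrite nrmZ ger0_norm ?(ltW d0) // mulrC ler_pM2r // -wYw.
  by apply: le_trans (nrmB _ _) _; rewrite lerD.
have wxw : nrm (w * x * w) <= 2 * d.
  apply: npos_bound; [by rewrite mulr_ge0 // ltW|exact: npos_conj|].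
  have -> : sc (2 * d) - w * x * w =
     (sc (2 * d) - w * y * w) + w * (y - x) * w by nc_ring.
  apply: nposD; last exact: npos_conj.
  by apply: npos_sub_small => //; apply: npos_sa; exact: npos_conj.
have [k [ks kk _]] := npos_sqrt xp d0.
have k2 : nrm k ^+ 2 <= nrm x + d.
  rewrite -nrm_starM ks kk; apply: le_trans (nrmD _ _) _.
  by rewrite nrm_sc ger0_norm // ltW.
have wk2 : nrm (w * k) ^+ 2 <= 3 * d.
  rewrite -nrm_Mstar star_mul ws ks.
  have -> : w * k * (k * w) = w * (k * k) * w by nc_ring.
  have -> : w * (k * k) * w = w * x * w + sc d * (w * w).
    by rewrite kk mulrDr mulrDl sc_comm !mulrA.
  apply: le_trans (nrmD _ _) _; rewrite nrmZ ger0_norm ?(ltW d0) //.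
  rewrite (_ : 3 * d = 2 * d + d * 1); last by ring.
  by rewrite lerD // ler_pM2l.
exists (x - w * x).
  have -> : x - w * x = y * (sc d^-1 * w * x).
    have -> : y * (sc d^-1 * w * x) = (y * sc d^-1) * w * x by nc_ring.
    rewrite sc_comm -/Y.
    have -> : Y * w * x = c * w * x - w * x by rewrite /c sc1; nc_ring.
    by rewrite cw mul1r.
  exact: Jmul.
rewrite opprB addrC subrK.
have -> : w * x = w * k * k - sc d * w.
  by rewrite -mulrA kk mulrDr sc_comm addrK.
apply: le_lt_trans (nrmB _ _) _; rewrite nrmZ ger0_norm ?(ltW d0) //.
have := nrmM (w * k) k.
have k0 := nrm_ge0 k; have wk0 := nrm_ge0 (w * k); have w0 := nrm_ge0 w.
have : nrm (w * k) * nrm k <= e / 2.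
  have := ler_pM (sqr_ge0 _) (sqr_ge0 _) wk2 k2; rewrite -exprMn => H.
  rewrite -(@ler_sqr _) ?nnegrE ?mulr_ge0 ?invr_ge0 ?(ltW e0) //.
  apply: le_trans H _; apply: le_trans dX.
  by rewrite ler_wpM2l ?mulr_ge0 ?(ltW d0) // lerD2l.
move: w1 de d0 w0; move: (nrm (w * k) * nrm k) (nrm (w * k * k)) (nrm w).
by move=> a b f *; nra.
Qed.

(** The algebraic ideal generated by [a] is dense, so it meets the open set of
    invertible elements. *)
Lemma simple_full (a : A) : simple_cstar A -> a != 0 ->
  exists s : seq (A * A), \sum_(p <- s) p.1 * a * p.2 = 1.
Proof.
move=> simple a0.
pose I := [set z : A | exists s : seq (A * A), z = \sum_(p <- s) p.1 * a * p.2].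
have ID u v : I u -> I v -> I (u + v).
  by move=> [s ->] [t ->]; exists (s ++ t); rewrite big_cat.
have Il (b u : A) : I u -> I (b * u).
  move=> [s ->]; exists [seq (b * p.1, p.2) | p <- s].
  by rewrite big_map mulr_sumr; apply: eq_bigr => p _; rewrite !mulrA.
have Ir (b u : A) : I u -> I (u * b).
  move=> [s ->]; exists [seq (p.1, p.2 * b) | p <- s].
  by rewrite big_map mulr_suml; apply: eq_bigr => p _; rewrite !mulrA.
have Ia : I a by exists [:: (1, 1)]; rewrite big_seq1 mul1r mulr1.
have small (b : A) e : 0 < e -> exists2 f, 0 < f & nrm b * f < e.
  move=> e0; have b0 := nrm_ge0 b.
  exists (e / (nrm b + 1)); first by rewrite divr_gt0 // ltr_wpDl.
  rewrite mulrCA gtr_pMr // ltr_pdivrMr ?mul1r ?ltrDl // ltr_wpDl //.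
have [||cl0|clT] := simple (closure I).
- split.
  + by apply: subset_closure; exists [::]; rewrite big_nil.
  + move=> x y /closureP Ix /closureP Iy; apply/closureP => e e0.
    have e2 : 0 < e / 2 by rewrite divr_gt0.
    have [u Iu xu] := Ix _ e2; have [v Iv yv] := Iy _ e2.
    exists (u + v); first exact: ID.
    have -> : x + y - (u + v) = (x - u) + (y - v) by nc_ring.
    by apply: le_lt_trans (nrmD _ _) _; lra.
  + move=> b x /closureP Ix; apply/closureP => e e0.
    have [f f0 bf] := small b _ e0; have [u Iu xu] := Ix _ f0.
    exists (b * u); first exact: Il.
    rewrite -mulrBr; apply: le_lt_trans (nrmM _ _) _; apply: le_lt_trans bf.
    by rewrite ler_wpM2l ?nrm_ge0 // ltW.
  + move=> b x /closureP Ix; apply/closureP => e e0.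
    have [f f0 bf] := small b _ e0; have [u Iu xu] := Ix _ f0.
    exists (u * b); first exact: Ir.
    rewrite -mulrBl; apply: le_lt_trans (nrmM _ _) _; apply: le_lt_trans bf.
    by rewrite mulrC ler_wpM2l ?nrm_ge0 // ltW.
- exact: closed_closure.
- have : closure I a by exact: subset_closure.
  by rewrite cl0 => /= aE; rewrite aE eqxx in a0.
have /closureP/(_ 1 ltr01)[z Iz z1] : closure I 1 by rewrite clT.
have [z' [zz' _]] := invertible_near1 z1.
by have [s] := Ir z' _ Iz; rewrite zz' => ->; exists s.
Qed.

Lemma setT_infinite_projection : purely_infinite A ->
  exists p : A, infinite_projection p.
Proof.
move=> pi; have [|||p _ pinf] := pi setT; [by do 2?split|by []| |by exists p].
move=> /seteqP[/(_ 1 I) /= /eqP]; by rewrite oner_eq0.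
Qed.

(** If [v] carries [p] onto the proper subprojection [q], the powers of [v] carry the
    gap [r = p - q] onto pairwise orthogonal subprojections of [p]. *)
Lemma infinite_projection_isometries (p : A) : infinite_projection p ->
  exists2 r, r != 0 & [/\ star r = r, r * r = r & exists w : nat -> A,
    (forall i, p * w i = w i) /\
    forall i j, star (w i) * w j = if i == j then r else 0].
Proof.
move=> [[ps pp] [q [[qs qq] pq qnp [v [vp vq]]]]].
have qp : q * p = q by rewrite -{1}qs -{1}ps -star_mul pq qs.
have vpv : v * p = v.
  apply/eqP; rewrite -subr_eq0; apply/eqP/nrm_eq0.
  have : nrm (v * p - v) ^+ 2 = 0.
    rewrite -nrm_starM starB star_mul ps.
    have -> : (p * star v - star v) * (v * p - v) =
      p * (star v * v) * p - p * (star v * v) - (star v * v) * p + star v * v.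
      by nc_ring.
    by rewrite vp !pp subrr sub0r addNr nrm0.
  by move/eqP; rewrite expf_eq0 => /eqP.
have qv : q * v = v by rewrite -vq -mulrA vp vpv.
have pv : p * v = v by rewrite -qv mulrA pq.
pose r := p - q.
have rr : r * r = r.
  have -> : r * r = p * p - p * q - q * p + q * q by rewrite /r; nc_ring.
  by rewrite pp pq qp qq subrK.
have rs : star r = r by rewrite starB ps qs.
have rv : r * v = 0 by rewrite mulrBl pv qv subrr.
have svr : star v * r = 0.
  by apply: (can_inj (@starK _ A)); rewrite star_mul starK rs rv star0.
have pr : p * r = r by rewrite mulrBr pp pq.
have svv n : star (v ^+ n) * (v ^+ n) * r = r.
  elim: n => [|n IH]; first by rewrite !expr0 star1 !mul1r.
  rewrite exprS star_mul.
  have -> : star (v ^+ n) * star v * (v * v ^+ n) * r =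
    star (v ^+ n) * ((star v * v) * (v ^+ n * r)) by nc_ring.
  rewrite vp; have -> : p * (v ^+ n * r) = v ^+ n * r.
    by case: (n) => [|m]; rewrite ?expr0 ?mul1r // exprS !mulrA pv.
  by rewrite mulrA.
exists r; first by apply/eqP => /eqP; rewrite subr_eq0 => /eqP/esym.
split=> //; exists (fun i => v ^+ i * r); split.
  by case=> [|i]; rewrite ?expr0 ?mul1r // exprS !mulrA pv.
have lt i j : (i < j)%N -> star (v ^+ i * r) * (v ^+ j * r) = 0.
  move=> ij; rewrite -(subnKC ij) addSnnS exprD star_mul rs.
  set m := (j - i.+1)%N.
  have -> : r * star (v ^+ i) * (v ^+ i * v ^+ m.+1 * r) =
    r * (star (v ^+ i) * v ^+ i * v ^+ m.+1) * r by nc_ring.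
  have svp n : star (v ^+ n) * v ^+ n * v = v.
    elim: n => [|n IH]; first by rewrite !expr0 star1 !mul1r.
    rewrite exprS star_mul.
    have -> : star (v ^+ n) * star v * (v * v ^+ n) * v =
      star (v ^+ n) * ((star v * v) * (v ^+ n * v)) by nc_ring.
    rewrite vp; have -> : p * (v ^+ n * v) = v ^+ n * v.
      by rewrite -exprSr exprS mulrA pv.
    by rewrite mulrA.
  by rewrite exprS (mulrA _ v) svp !mulrA rv !mul0r.
move=> i j; case: ltngtP => [ij|ji|->].
- exact: lt.
- apply: (can_inj (@starK _ A)); rewrite star_mul starK star0; exact: lt.
- rewrite star_mul rs.
  have -> : r * star (v ^+ j) * (v ^+ j * r) = r * (star (v ^+ j) * v ^+ j * r).
    by nc_ring.
  by rewrite svv.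
Qed.

(** A sum [\sum_i c_i r d_i = 1] becomes a single product because [p] contains
    orthogonal copies [w_i] of [r], one for each term: with [w_i'] the adjoints,
    [(\sum_i c_i w_i') p (\sum_i w_i d_i) = \sum_i c_i r d_i]. *)
Lemma infinite_projection_full (p : A) : simple_cstar A -> infinite_projection p ->
  exists c d : A, c * p * d = 1.
Proof.
move=> simple /infinite_projection_isometries[r r0 [_ _ [w [pw ww]]]].
have [s sE] := simple_full simple r0.
pose S (i : 'I_(size s)) := nth (0, 0) s i.
exists (\sum_(i < size s) (S i).1 * star (w i)), (\sum_(i < size s) w i * (S i).2).
have pd : p * (\sum_(i < size s) w i * (S i).2) = \sum_(i < size s) w i * (S i).2.
  by rewrite mulr_sumr; apply: eq_bigr => i _; rewrite mulrA pw.
rewrite -mulrA pd mulr_suml -sE (big_nth (0, 0)) big_mkord.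
apply: eq_bigr => i _; rewrite mulr_sumr (bigD1 i) //= [X in _ + X]big1 ?addr0.
  by rewrite -mulrA (mulrA (star _)) ww eqxx mulrA.
move=> j ji; rewrite -mulrA (mulrA (star _)) ww ifN ?mul0r ?mulr0 //.
by rewrite eq_sym; apply: contraNneq ji => ij; apply/eqP/val_inj.
Qed.

Lemma nonzero_full (a : A) : simple_cstar A -> purely_infinite A -> a != 0 ->
  exists b c : A, b * a * c = 1.
Proof.
move=> simple pi a0.
pose J x := forall e, 0 < e -> exists c, nrm (x - a * c) < e.
have Jcl l : (forall e, 0 < e -> exists2 u, J u & nrm (l - u) < e) -> J l.
  move=> H e e0; have e2 : 0 < e / 2 by rewrite divr_gt0.
  have [u Ju lu] := H _ e2; have [c uc] := Ju _ e2; exists c.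
  have -> : l - a * c = (l - u) + (u - a * c) by nc_ring.
  by apply: le_lt_trans (nrmD _ _) _; lra.
have Jmul z b : J z -> J (z * b).
  move=> Jz e e0; have b0 := nrm_ge0 b.
  have [|c zc] := Jz (e / (nrm b + 1)); first by rewrite divr_gt0 // ltr_wpDl.
  exists (c * b); rewrite mulrA -mulrBl; apply: le_lt_trans (nrmM _ _) _.
  rewrite ltr_pdivlMr ?ltr_wpDl // in zc; apply: le_lt_trans zc.
  by rewrite ler_wpM2l ?nrm_ge0 // lerDl.
have JD x y : J x -> J y -> J (x + y).
  move=> Jx Jy e e0; have e2 : 0 < e / 2 by rewrite divr_gt0.
  have [c xc] := Jx _ e2; have [d yd] := Jy _ e2; exists (c + d).
  have -> : x + y - a * (c + d) = (x - a * c) + (y - a * d) by nc_ring.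
  by apply: le_lt_trans (nrmD _ _) _; lra.
have J0 : J 0 by move=> e e0; exists 0; rewrite mulr0 subrr nrm0.
have JZ (l : R[i]) x : J x -> J (l *: x).
  by move=> Jx; rewrite -(mulr1 x) scalerAr; exact: Jmul.
pose B := [set x : A | J x /\ J (star x)].
have [||B0|p [Jp _] pinf] := pi B.
- split.
  + split; first by split=> //; rewrite star0.
    apply/closure_id/seteqP; split; first exact: subset_closure.
    move=> x /closureP clx; split; apply: Jcl => e /clx[u [Ju Jsu] xu].
      by exists u.
    by exists (star u) => //; rewrite -starB nrm_star.
  + by move=> x y [Jx Jsx] [Jy Jsy]; split; rewrite ?starD; exact: JD.
  + by move=> l x [Jx Jsx]; split; rewrite ?starZ; exact: JZ.
  + by move=> x y [Jx Jsx] [Jy Jsy]; split; rewrite ?star_mul; exact: Jmul.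
  + by move=> x [Jx Jsx]; split; rewrite ?starK.
- move=> x y xp yxp [Jy _].
  have Jx : J x.
    exact: hereditary_right_ideal Jmul Jcl (positive_npos xp) (positive_npos yxp) Jy.
  by split=> //; case: xp => ->.
- have Baa : B (a * star a).
    have Jaa : J (a * star a) by move=> e e0; exists (star a); rewrite subrr nrm0.
    by split; rewrite ?star_mul ?starK.
  move: Baa; rewrite B0 /= => aa.
  have : nrm a ^+ 2 = 0 by rewrite -nrm_Mstar aa nrm0.
  by move/eqP; rewrite expf_eq0 => /eqP/nrm_eq0/eqP; rewrite (negPf a0).
have [c [d cpd]] := infinite_projection_full simple pinf.
have C0 : 0 <= nrm c * nrm d by rewrite mulr_ge0 ?nrm_ge0.
have [|b pb] := Jp (1 / (nrm c * nrm d + 1)); first by rewrite divr_gt0 // ltr_wpDl.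
have : nrm (1 - c * (a * b) * d) < 1.
  have -> : 1 - c * (a * b) * d = c * (p - a * b) * d by rewrite -cpd; nc_ring.
  rewrite ltr_pdivlMr ?ltr_wpDl // in pb.
  have := nrmM (c * (p - a * b)) d; have := nrmM c (p - a * b).
  have := nrm_ge0 c; have := nrm_ge0 d; have := nrm_ge0 (p - a * b).
  move: pb; move: (nrm (p - a * b)) (nrm (c * (p - a * b))) (nrm c) (nrm d) (nrm _).
  by move=> *; nra.
move=> /invertible_near1[z [hz _]].
exists c, (b * d * z); rewrite -hz; nc_ring.
Qed.

(** * Averaging over isometries and density *)

(** The square of the norm is the norm of [\sum_i w_i x' r x w_i'], primes denoting
    adjoints, a sum of [n] terms of norm at most [nrm x ^+ 2].  The resulting growth like the square root
    of [n] is all that averaging over [n] terms requires. *)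
Lemma nrm_sum_isometries (w : nat -> A) (r : A) (n : nat) (x : A) :
  star r = r -> r * r = r ->
  (forall i j, star (w i) * w j = if i == j then r else 0) ->
  nrm (\sum_(i < n) w i * x * star (w i)) ^+ 2 <= n%:R * nrm x ^+ 2.
Proof.
move=> rs rr ww.
have r1 : nrm r <= 1.
  have : nrm r ^+ 2 = nrm r by rewrite -nrm_starM rs rr.
  by have := nrm_ge0 r; move: (nrm r) => a *; nra.
have w1 i : nrm (w i) <= 1.
  have : nrm (w i) ^+ 2 <= 1 by rewrite -nrm_starM ww eqxx.
  by have := nrm_ge0 (w i); move: (nrm _) => a *; nra.
rewrite -nrm_starM star_sum.
have -> : (\sum_(i < n) star (w i * x * star (w i))) *
    (\sum_(i < n) w i * x * star (w i)) =
    \sum_(i < n) w i * (star x * r * x) * star (w i).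
  rewrite mulr_suml; apply: eq_bigr => i _.
  rewrite mulr_sumr (bigD1 i) //= [X in _ + X]big1 ?addr0 => [|j ji].
    rewrite !star_mul starK.
    have -> : w i * (star x * star (w i)) * (w i * x * star (w i)) =
      w i * star x * (star (w i) * w i) * x * star (w i) by nc_ring.
    by rewrite ww eqxx !mulrA.
  rewrite !star_mul starK.
  have -> : w i * (star x * star (w i)) * (w j * x * star (w j)) =
      w i * star x * (star (w i) * w j) * x * star (w j) by nc_ring.
  rewrite ww ifN ?mulr0 ?mul0r //.
  by rewrite eq_sym; apply: contraNneq ji => ij; apply/eqP/val_inj.
have term i : nrm (w i * (star x * r * x) * star (w i)) <= nrm x ^+ 2.
  apply: le_trans (nrmM _ _) _; rewrite nrm_star -[leRHS]mulr1.
  apply: ler_pM; rewrite ?nrm_ge0 //.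
  apply: le_trans (nrmM _ _) _; rewrite -[leRHS]mul1r.
  apply: ler_pM; rewrite ?nrm_ge0 //.
  apply: le_trans (nrmM _ _) _; rewrite expr2; apply: ler_pM; rewrite ?nrm_ge0 //.
  apply: le_trans (nrmM _ _) _; rewrite nrm_star -[leRHS]mulr1.
  by apply: ler_pM; rewrite ?nrm_ge0.
elim: n => [|n IH]; first by rewrite big_ord0 nrm0 mul0r.
rewrite big_ord_recr /= -natr1 mulrDl mul1r.
by apply: le_trans (nrmD _ _) _; rewrite lerD.
Qed.

(** Sandwiching orthogonal copies of a full projection [r], with [1 = a r b],
    between [a] and [b] gives one-sided inverses instead of isometries; the constant
    [C] does not depend on [n], which keeps the square root growth. *)
Lemma cuntz_family : simple_cstar A -> purely_infinite A ->
  exists (s s' : nat -> A) (C : R),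
  [/\ 0 <= C, forall i j, s' i * s j = (i == j)%:R &
    forall n x, nrm (\sum_(i < n) s i * x * s' i) ^+ 2 <= n%:R * (C * nrm x) ^+ 2].
Proof.
move=> simple pi.
have [p pinf] := setT_infinite_projection pi.
have [r r0 [rs rr [w [_ ww]]]] := infinite_projection_isometries pinf.
have [a [b arb]] := nonzero_full simple pi r0.
exists (fun i => w i * b), (fun i => a * star (w i)), (nrm b * nrm a).
split=> [|i j|n x]; first by rewrite mulr_ge0 ?nrm_ge0.
  have -> : a * star (w i) * (w j * b) = a * (star (w i) * w j) * b by nc_ring.
  by rewrite ww; case: eqP => _; rewrite ?arb // mulr0 mul0r.
have -> : \sum_(i < n) w i * b * x * (a * star (w i)) =
    \sum_(i < n) w i * (b * x * a) * star (w i).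
  by apply: eq_bigr => i _; nc_ring.
apply: le_trans (nrm_sum_isometries _ _ rs rr ww) _.
rewrite ler_wpM2l // ler_sqr ?nnegrE ?mulr_ge0 ?nrm_ge0 //.
apply: le_trans (nrmM _ _) _; rewrite mulrAC ler_wpM2r ?nrm_ge0 //.
exact: nrmM.
Qed.

(** The equation is [n c = t + P c], where the operator [P] has norm [O(sqrt n)], so
    for large [n] it is a contracting fixed point problem. *)
Lemma average_solvable (s s' : nat -> A) (C : R) (u u' : A) :
  0 <= C ->
  (forall n x, nrm (\sum_(i < n) s i * x * s' i) ^+ 2 <= n%:R * (C * nrm x) ^+ 2) ->
  exists n : nat, forall t : A, exists c : A,
    t = \sum_(i < n) (c - u * s i * c * (s' i * u')).
Proof.
move=> C0 sC; pose K := nrm u * nrm u' * C.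
have K0 : 0 <= K by rewrite !mulr_ge0 ?nrm_ge0.
(* Squaring [K * sqrt n <= n / 2] gives the bound on [n]. *)
pose n := (Num.bound (4 * K ^+ 2)).+1; exists n => t.
have nK : 4 * K ^+ 2 <= n%:R.
  have := @archi_boundP _ (4 * K ^+ 2); rewrite mulr_ge0 ?exprn_ge0 // => /(_ isT) /ltW.
  by move/le_trans; apply; rewrite ler_nat.
have n0 : 0 < n%:R :> R by rewrite ltr0n.
pose P c := u * (\sum_(i < n) s i * c * s' i) * u'.
have PB c d : P c - P d = P (c - d).
  rewrite /P -mulrBl -mulrBr -sumrB; congr (_ * _ * _).
  by apply: eq_bigr => i _; nc_ring.
have Pn c : nrm (P c) <= n%:R / 2 * nrm c.
  rewrite -(@ler_sqr R) ?nnegrE ?mulr_ge0 ?nrm_ge0 ?invr_ge0 //.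
  have : nrm (P c) <= nrm u * nrm u' * nrm (\sum_(i < n) s i * c * s' i).
    apply: le_trans (nrmM _ _) _; rewrite mulrAC ler_wpM2r ?nrm_ge0 //.
    exact: nrmM.
  move=> Pc; apply: (@le_trans _ _
    ((nrm u * nrm u' * nrm (\sum_(i < n) s i * c * s' i)) ^+ 2)).
    by rewrite ler_sqr ?nnegrE ?mulr_ge0 ?nrm_ge0.
  rewrite exprMn; apply: le_trans (ler_wpM2l (sqr_ge0 _) (sC n c)) _.
  have -> : (nrm u * nrm u') ^+ 2 * (n%:R * (C * nrm c) ^+ 2) =
     n%:R * nrm c ^+ 2 * (K ^+ 2) by rewrite /K; ring.
  have -> : (n%:R / 2 * nrm c) ^+ 2 = n%:R * nrm c ^+ 2 * (n%:R / 4) :> R by field.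
  rewrite ler_wpM2l ?mulr_ge0 ?exprn_ge0 ?nrm_ge0 //.
  by rewrite ler_pdivlMr // mulrC.
have [|||||c _ cE] := @fixed_point (fun=> True)
  (fun c => sc n%:R^-1 * (t + P c)) 2^-1 0.
- by rewrite invr_ge0 ler0n /= invf_lt1 ?ltr1n ?ltr0n.
- by [].
- by [].
- move=> c d _ _.
  have -> : sc n%:R^-1 * (t + P c) - sc n%:R^-1 * (t + P d) =
     sc n%:R^-1 * (P c - P d) by nc_ring.
  rewrite PB nrmZ ger0_norm ?invr_ge0 //.
  apply: le_trans (ler_wpM2l _ (Pn _)) _; first by rewrite invr_ge0.
  by rewrite !mulrA mulVf ?gt_eqF // mul1r.
- by [].
exists c; rewrite sumrB sumr_const card_ord.
have -> : c *+ n = sc n%:R * c.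
  by rewrite /sc rmorph_nat -scalerAl mul1r scaler_nat.
have -> : \sum_(i < n) u * s i * c * (s' i * u') = P c.
  by rewrite /P mulr_sumr mulr_suml; apply: eq_bigr => i _; nc_ring.
by rewrite -{1}cE mulrA -scM divff ?gt_eqF // sc1 mul1r addrK.
Qed.

(** If [(1 - f) x f = 0], the element [c = (1 - f) c f] with [c != 0] is added with a
    small coefficient; otherwise [x] itself is a sum of two nilpotents. *)
Lemma nilpotent_sums_dense (x : A) : simple_cstar A -> purely_infinite A ->
  forall e, 0 < e -> exists2 y, 
    (exists u l, [/\ nilpotent_element u, nilpotent_element l & y = u + l]) &
    nrm (x - y) < e.
Proof.
move=> simple pi e e0.
have [s [s' [C [C0 s's sC]]]] := cuntz_family simple pi.
pose f := s 0%N * s' 0%N.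
have ff : f * f = f.
  have -> : f * f = s 0%N * (s' 0%N * s 0%N) * s' 0%N by rewrite /f; nc_ring.
  by rewrite s's eqxx mulr1.
have exact_sum y : (1 - f) * y * f != 0 ->
    exists u l, [/\ nilpotent_element u, nilpotent_element l & y = u + l].
  move=> fy.
  have full (a : A) := @nonzero_full a simple pi.
  have [v [a [b [av bv axv bxv]]]] := independent_frame full ff fy.
  have [n solv] := average_solvable (v * s 0%N) (s' 0%N * a) C0 sC.
  exact: independent_frame_nilpotent_sum av bv axv bxv s's solv.
have [fx|fx] := eqVneq ((1 - f) * x * f) 0; last first.
  by exists x; [exact: exact_sum|rewrite subrr nrm0].
pose c := s 1%N * s' 0%N.
have fc : (1 - f) * c * f = c.
  have -> : (1 - f) * c * f = s 1%N * (s' 0%N * s 0%N) * s' 0%N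
     - s 0%N * (s' 0%N * s 1%N) * s' 0%N * f by rewrite /c /f; nc_ring.
  by rewrite !s's /= mulr1 mulr0 !mul0r subr0.
have c0 : c != 0.
  apply/eqP => c0; have : s' 1%N * c * s 0%N = 1.
    have -> : s' 1%N * c * s 0%N = (s' 1%N * s 1%N) * (s' 0%N * s 0%N).
      by rewrite /c; nc_ring.
    by rewrite !s's mulr1.
  by rewrite c0 mulr0 mul0r => /eqP; rewrite eq_sym oner_eq0.
pose d := e / (nrm c + 1); have nc0 := nrm_ge0 c.
have d0 : 0 < d by rewrite divr_gt0 // ltr_wpDl.
exists (x + sc d * c).
  apply: exact_sum.
  have -> : (1 - f) * (x + sc d * c) * f =
     (1 - f) * x * f + (1 - f) * sc d * c * f by nc_ring.
  rewrite fx add0r sc_comm.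
  have -> : sc d * (1 - f) * c * f = sc d * ((1 - f) * c * f) by nc_ring.
  rewrite fc.
  apply: contra_neq c0 => dc.
  by rewrite -[c]mul1r -sc1 -(mulVf (lt0r_neq0 d0)) scM -mulrA dc mulr0.
rewrite opprD addrA subrr sub0r nrmN nrmZ ger0_norm ?(ltW d0) //.
by rewrite /d mulrAC ltr_pdivrMr ?ltr_wpDl // ltr_pM2l // ltrDl.
Qed.

End CStar.

Theorem theorem2p10 (R : realType) (A : cstarAlgType R)
    (hsimple : simple_cstar A) (hpi : purely_infinite A) :
  [set x : A | selfadjoint x] `<=`
    closure [set x : A | exists M1 M2 : A,
      [/\ nilpotent_element M1, nilpotent_element M2 & x = M1 + M2]]
  /\
  [set: A] `<=`
    closure [set x : A | exists M1 M2 M3 M4 : A,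
      [/\ nilpotent_element M1, nilpotent_element M2, nilpotent_element M3,
          nilpotent_element M4 & x = M1 + M2 + M3 + M4]].
Proof.
have dense x := nilpotent_sums_dense x hsimple hpi.
split=> x _; apply/closureP => e e0; have [y [u [l [un ln yE]]] xy] := dense x e e0.
  by exists y => //; exists u, l.
have nil0 : nilpotent_element (0 : A) by exists 1%N; rewrite expr1.
by exists y => //; exists u, l, 0, 0; rewrite !addr0; split.
Qed.
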